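(* Let $K$ be a field of characteristic zero with a discrete, non-archimedean valuation, let $f,g\in K[z]$ be polynomials with $1\le \deg(g)<\deg(f)$, let $C$ be the (polarized) correspondence $g(y)=f(x)$, and let $\alpha\in K$. Assume that (1) $C$ has good reduction; (2) $\deg(f)$ and $\deg(g)$ are units in the valuation ring of $K$; (3) $\gcd(\deg(f),\deg(g))=1$; and (4) $\alpha$ is not integral. Write $d=\deg(f)$, and let $G\subseteq \operatorname{Aut}(P_{C,\alpha})$ be the image of $\operatorname{Gal}(\overline{K}/K)$. Then there is a $d$-adic subgroup $H\subseteq \operatorname{Aut}(P_{C,\alpha})$ such that $G\cap H$ has finite index in $H$.
   Context: $\overline{K}$ is an algebraic closure of $K$. ''Integral'' means lying in the valuation ring of $K$. The correspondence $C: g(y)=f(x)$ is viewed as the directed graph with vertex set $\overline{K}$ and an edge from $x$ to $y$ if and only if $g(y)=f(x)$. It is called polarized if $\deg(g)<\deg(f)$. It has good reduction if the coefficients of $f$ and $g$ are integral and the leading coefficient of each is a unit of the valuation ring. $P_{C,\alpha}$ is the subgraph of backward paths from $\alpha$: it consists of the vertices and edges lying on directed paths ending at $\alpha$, i.e. occurring in finite sequences $\alpha_0=\alpha,\alpha_1,\dots,\alpha_n$ in $\overline{K}$ with $g(\alpha_i)=f(\alpha_{i+1})$. It is regarded as a $d$-branching rooted tree with root $\alpha$, the elements directly above a vertex $y$ being the $x$ with $g(y)=f(x)$. $\operatorname{Aut}(P_{C,\alpha})$ is its automorphism group as an abstract graph with marked point $\alpha$. Since $\alpha\in K$ and $f,g\in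 K[z]$, the group $\operatorname{Gal}(\overline{K}/K)$ acts on $P_{C,\alpha}$. $d$-adic subgroups: let $T$ be the regular $d$-branching rooted tree whose vertex set is the disjoint union $\bigsqcup_{n\ge 0}\mathbb{Z}/d^n\mathbb{Z}$, with $g_{n+1}\in\mathbb{Z}/d^{n+1}\mathbb{Z}$ sitting directly above $g_n\in\mathbb{Z}/d^n\mathbb{Z}$ if and only if $g_{n+1}\equiv g_n \pmod{d^n}$. The group $\varprojlim \mathbb{Z}/d^n\mathbb{Z}$ acts faithfully on $T$, with $(h_0,h_1,\dots)$ sending $g_n\in\mathbb{Z}/d^n\mathbb{Z}$ to $h_n+g_n$. For an infinite $d$-branching rooted tree $T'$, a subgroup of $\operatorname{Aut}(T')$ is called a $d$-adic subgroup if it is the image of $\varprojlim\mathbb{Z}/d^n\mathbb{Z}\subseteq\operatorname{Aut}(T)$ under the isomorphism $\operatorname{Aut}(T)\cong\operatorname{Aut}(T')$ induced by some isomorphism of rooted trees $T\cong T'$ (i.e. it arises as this group for some labelling of the vertices of $T'$). *)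

(* Defs.v *)
From HB Require Import structures.
From mathcomp Require Import all_boot all_order all_algebra.
From mathcomp Require Import boolp classical_sets cardinality.

Set Implicit Arguments.
Unset Strict Implicit.
Unset Printing Implicit Defensive.

Import Order.TTheory GRing.Theory Num.Theory.
Local Open Scope classical_set_scope.
Local Open Scope ring_scope.

(** * Discrete valuations *)

(* Additive notation. The value [v 0], morally +oo, is left unconstrained, so
   every use of [v x] is guarded by [x != 0]. The value group is a nonzero
   subgroup of Z; it is not required to be all of Z. *)
Record discrete_valuation (K : fieldType) := DiscreteValuation {
  dval :> K -> int;
  dvalM : forall x y : K, x != 0 -> y != 0 -> dval (x * y) = dval x + dval y;
  dvalD : forall x y : K, x != 0 -> y != 0 -> x + y != 0 ->
    Num.min (dval x) (dval y) <= dval (x + y);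
  dval_nontrivial : exists2 x : K, x != 0 & dval x != 0 }.

Definition vring (K : fieldType) (v : discrete_valuation K) : {pred K} :=
  [pred x | (x == 0) || (0 <= v x)].

Definition vunit (K : fieldType) (v : discrete_valuation K) (x : K) : Prop :=
  [/\ x != 0, x \in vring v & x^-1 \in vring v].

Definition pdeg (K : fieldType) (p : {poly K}) : nat := (size p).-1.

Definition good_reduction (K : fieldType) (v : discrete_valuation K)
    (f g : {poly K}) : Prop :=
  [/\ f \is a polyOver (vring v), g \is a polyOver (vring v),
      vunit v (lead_coef f) & vunit v (lead_coef g)].

(** * Directed graphs with a marked point *)

Record rgraph := RGraph {
  vertex :> Type;
  edge : vertex -> vertex -> Prop;
  root : vertex }.

Record rgraph_iso (S T : rgraph) := RGraphIso {
  iso_fun :> S -> T;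
  iso_inv : T -> S;
  iso_funK : cancel iso_fun iso_inv;
  iso_invK : cancel iso_inv iso_fun;
  iso_edge : forall x y : S, edge x y <-> edge (iso_fun x) (iso_fun y);
  iso_root : iso_fun (root S) = root T }.

Lemma rgraph_isoP (S T : rgraph) (a b : rgraph_iso S T) : a =1 b -> a = b.
Proof.
case: a b => [f f' fK f'K fe fr] [g g' gK g'K ge gr] /= /funext fg.
move: g gK g'K ge gr fg => g gK g'K ge gr fg; subst g.
have fg' : f' = g' by apply/funext => y; rewrite -{1}(g'K y) fK.
subst g'; congr RGraphIso; exact: Prop_irrelevance.
Qed.

Definition iso_id (S : rgraph) : rgraph_iso S S :=
  @RGraphIso S S id id (fun=> erefl) (fun=> erefl) (fun _ _ => iff_refl _) erefl.

Definition iso_comp (S T U : rgraph) (b : rgraph_iso T U) (a : rgraph_iso S T) :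
  rgraph_iso S U.
Proof.
exists (b \o a) (iso_inv a \o iso_inv b).
- exact: can_comp (iso_funK b) (iso_funK a).
- exact: can_comp (iso_invK a) (iso_invK b).
- by move=> x y; rewrite (iso_edge a) (iso_edge b).
- by rewrite /= !iso_root.
Defined.

Definition iso_sym (S T : rgraph) (a : rgraph_iso S T) : rgraph_iso T S.
Proof.
exists (iso_inv a) a.
- exact: iso_invK.
- exact: iso_funK.
- by move=> x y; rewrite (iso_edge a) !iso_invK.
- by rewrite -(iso_root a) iso_funK.
Defined.

Definition Aut (S : rgraph) : Type := rgraph_iso S S.

HB.instance Definition _ (S : rgraph) := gen_eqMixin (Aut S).
HB.instance Definition _ (S : rgraph) := gen_choiceMixin (Aut S).

Lemma iso_compA (S : rgraph) :
  associative (@iso_comp S S S : Aut S -> Aut S -> Aut S).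
Proof. by move=> a b c; apply: rgraph_isoP. Qed.

Lemma iso_comp1l (S : rgraph) :
  left_id (iso_id S : Aut S) (@iso_comp S S S : Aut S -> Aut S -> Aut S).
Proof. by move=> a; apply: rgraph_isoP. Qed.

Lemma iso_comp1r (S : rgraph) :
  right_id (iso_id S : Aut S) (@iso_comp S S S : Aut S -> Aut S -> Aut S).
Proof. by move=> a; apply: rgraph_isoP. Qed.

Lemma iso_compVl (S : rgraph) :
  left_inverse (iso_id S : Aut S) (@iso_sym S S : Aut S -> Aut S)
    (@iso_comp S S S : Aut S -> Aut S -> Aut S).
Proof. by move=> a; apply: rgraph_isoP => x /=; rewrite iso_funK. Qed.

Lemma iso_compVr (S : rgraph) :
  right_inverse (iso_id S : Aut S) (@iso_sym S S : Aut S -> Aut S)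
    (@iso_comp S S S : Aut S -> Aut S -> Aut S).
Proof. by move=> a; apply: rgraph_isoP => x /=; rewrite iso_invK. Qed.

HB.instance Definition _ (S : rgraph) :=
  isGroup.Build (Aut S) (@iso_compA S) (@iso_comp1l S) (@iso_comp1r S)
    (@iso_compVl S) (@iso_compVr S).

Definition aut_transport (S T : rgraph) (phi : rgraph_iso S T) (a : Aut S) :
  Aut T := iso_comp phi (iso_comp a (iso_sym phi)).

(* [A] is meant to be a subgroup of [B]. *)
Definition finite_index (gT : groupType) (A B : set gT) : Prop :=
  finite_set [set [set (x * a)%g | a in A] | x in B].

(** * d-adic subgroups *)

(* Z/d^nZ for d > 0. The library's ['Z_m] denotes Z/2Z when m = 1, so it cannot
   be used at level 0; ['I_k.+1] carries addition mod k.+1 for every k. *)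
Definition Zmod (d n : nat) : zmodType := 'I_(d ^ n).-1.+1.

Definition Zred (d n : nat) (a : Zmod d n.+1) : Zmod d n := inZp (val a).

Record Zd_lim (d : nat) := ZdLim {
  Zd_coord :> forall n, Zmod d n;
  Zd_compat : forall n, Zred (Zd_coord n.+1) = Zd_coord n }.

Definition dtree_edge (d : nat) (x y : {n : nat & Zmod d n}) : Prop :=
  tag x = (tag y).+1 /\ inZp (val (tagged x)) = tagged y.

Definition dtree (d : nat) : rgraph :=
  @RGraph {n : nat & Zmod d n} (@dtree_edge d) (Tagged (Zmod d) (0 : Zmod d 0)).

Lemma Zmod_dvd (d n : nat) : ((d ^ n).-1.+1 %| (d ^ n.+1).-1.+1)%N.
Proof.
case: d => [|d]; last by rewrite !prednK ?expn_gt0 // expnS dvdn_mull.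
by rewrite (_ : (0 ^ n).-1.+1 = 1)%N ?dvd1n //; case: n => [|n]; rewrite ?expn0 ?exp0n.
Qed.

Lemma ZredD (d n : nat) (a b : Zmod d n.+1) :
  Zred (a + b) = Zred a + Zred b.
Proof.
apply: val_inj; rewrite /= modnDm.
by rewrite modn_dvdm // Zmod_dvd.
Qed.

Definition dtree_shift (d : nat) (h : Zd_lim d) (x : dtree d) : dtree d :=
  Tagged (Zmod d) (h (tag x) + tagged x).

Definition dtree_unshift (d : nat) (h : Zd_lim d) (x : dtree d) : dtree d :=
  Tagged (Zmod d) (- h (tag x) + tagged x).

Definition dtree_act (d : nat) (h : Zd_lim d) : Aut (dtree d).
Proof.
exists (dtree_shift h) (dtree_unshift h).
- by case=> n a; rewrite /dtree_unshift /dtree_shift /= addKr.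
- by case=> n a; rewrite /dtree_unshift /dtree_shift /= addNKr.
- case=> m a [n b]; rewrite /edge /= /dtree_edge /=.
  split=> -[mE]; move: a; rewrite mE => a ab; split=> //.
    by rewrite -[LHS]/(Zred (h n.+1 + a)) ZredD Zd_compat /Zred ab.
  have := ZredD (h n.+1) a.
  rewrite -[LHS]/(inZp (val (h n.+1 + a))) ab Zd_compat.
  by move/addrI => ->.
- congr (Tagged _ _); apply: val_inj => /=; exact: modn1.
Defined.

Definition dadic_subgroup (d : nat) (T : rgraph) (H : set (Aut T)) : Prop :=
  exists phi : rgraph_iso (dtree d) T,
    H = range (fun h : Zd_lim d => aut_transport phi (dtree_act h)).

(** * The correspondence g(y) = f(x) and its backward paths *)

(* [corr iota f g y x] means that there is an edge from [x] to [y]; the order of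
   arguments makes a backward path a [path] for this relation. *)
Definition corr (K : fieldType) (L : closedFieldType) (iota : {rmorphism K -> L})
    (f g : {poly K}) : rel L :=
  fun y x => (map_poly iota g).[y] == (map_poly iota f).[x].

Definition in_back_path (K : fieldType) (L : closedFieldType)
    (iota : {rmorphism K -> L}) (f g : {poly K}) (alpha : K) (x : L) : Prop :=
  exists2 s : seq L, path (corr iota f g) (iota alpha) s & x \in iota alpha :: s.

Lemma in_back_path_root (K : fieldType) (L : closedFieldType)
    (iota : {rmorphism K -> L}) (f g : {poly K}) (alpha : K) :
  in_back_path iota f g alpha (iota alpha).
Proof. by exists [::]; rewrite ?mem_seq1. Qed.

(* An edge of the correspondence both of whose ends are on backward paths from
   [alpha] is itself on such a path, so this is an induced subgraph. *)
Definition back_tree (K : fieldType) (L : closedFieldType)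
    (iota : {rmorphism K -> L}) (f g : {poly K}) (alpha : K) : rgraph :=
  @RGraph {x : L | in_back_path iota f g alpha x}
    (fun x y => corr iota f g (sval y) (sval x))
    (exist _ (iota alpha) (in_back_path_root iota f g alpha)).

(** * The Galois action *)

Record galois (K : fieldType) (L : closedFieldType) (iota : {rmorphism K -> L}) :=
  Galois {
    gal_fun :> {rmorphism L -> L};
    gal_inv : L -> L;
    gal_funK : cancel gal_fun gal_inv;
    gal_invK : cancel gal_inv gal_fun;
    gal_fix : forall a : K, gal_fun (iota a) = iota a }.

Lemma back_tree_inj (K : fieldType) (L : closedFieldType)
    (iota : {rmorphism K -> L}) (f g : {poly K}) (alpha : K)
    (x y : back_tree iota f g alpha) : sval x = sval y -> x = y.
Proof.
case: x y => [x px] [y py] /= xy; subst y; congr exist; exact: Prop_irrelevance.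
Qed.

Section GaloisAction.
Context (K : fieldType) (L : closedFieldType) (iota : {rmorphism K -> L}).
Context (f g : {poly K}) (alpha : K) (s : galois iota).

Lemma gal_horner (p : {poly K}) (x : L) :
  (map_poly iota p).[s x] = s (map_poly iota p).[x].
Proof.
rewrite -horner_map -map_poly_comp; congr horner.
by apply: eq_map_poly => a /=; rewrite gal_fix.
Qed.

Lemma gal_corr (y x : L) : corr iota f g (s y) (s x) = corr iota f g y x.
Proof. by rewrite /corr !gal_horner (can_eq (gal_funK s)). Qed.

Lemma gal_inv_corr (y x : L) :
  corr iota f g (gal_inv s y) (gal_inv s x) = corr iota f g y x.
Proof. by rewrite -gal_corr !gal_invK. Qed.

Lemma gal_inv_fix (a : K) : gal_inv s (iota a) = iota a.
Proof. by rewrite -{1}(gal_fix s a) gal_funK. Qed.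

Lemma back_path_map (h : L -> L) (x : L) :
  (forall y z, corr iota f g (h y) (h z) = corr iota f g y z) ->
  h (iota alpha) = iota alpha ->
  in_back_path iota f g alpha x -> in_back_path iota f g alpha (h x).
Proof.
move=> hc ha [t pt xt]; exists (map h t); last by rewrite -{1}ha -map_cons map_f.
rewrite -ha path_map; apply: sub_path pt => y z; by rewrite /relpre /= hc.
Qed.

Definition gal_act_fun (x : back_tree iota f g alpha) :
    back_tree iota f g alpha :=
  exist _ (s (sval x)) (back_path_map gal_corr (gal_fix s alpha) (svalP x)).

Definition gal_act_inv (x : back_tree iota f g alpha) :
    back_tree iota f g alpha :=
  exist _ (gal_inv s (sval x))
    (back_path_map gal_inv_corr (gal_inv_fix alpha) (svalP x)).

Definition gal_act : Aut (back_tree iota f g alpha).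
Proof.
exists gal_act_fun gal_act_inv.
- by move=> x; apply: back_tree_inj => /=; rewrite gal_funK.
- by move=> x; apply: back_tree_inj => /=; rewrite gal_invK.
- by move=> x y; rewrite /edge /= gal_corr.
- by apply: back_tree_inj => /=; rewrite gal_fix.
Defined.

End GaloisAction.

Definition gal_image (K : fieldType) (L : closedFieldType)
    (iota : {rmorphism K -> L}) (f g : {poly K}) (alpha : K) :
    set (Aut (back_tree iota f g alpha)) :=
  range (@gal_act K L iota f g alpha).
Arguments gal_image {K L} iota f g alpha.

(* Main.v *)
(** Extend [v] to a valuation ring [A] of [L], with maximal ideal m.  For large
    [x], [f(x)] is [lead_coef f * x ^ d] up to a factor in 1 + m, and two large
    points with the same value under [f] and the same class mod 1 + m coincide,
    [d] being a unit.  As [deg g] is prime to [d], the vertices of level [n] are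
    therefore in bijection with a torsor under the [d^n]-th roots of unity, via
    their classes mod 1 + m; compatible generators of these groups label the
    tree by the Z/d^n, and an automorphism that preserves [A] and fixes the
    roots of unity acts by a shift.

    There are many such automorphisms because the values of the level [n]
    vertices are [(deg g / d)^n v(alpha)].  Let [J] be the group of those
    automorphisms of a finite normal level that preserve [A] and fix the
    [d^n]-th roots of unity.  Averaging the norm over [J] of a vertex against a
    power of an element that isolates [A] among its conjugates gives an element
    of [K] with the value of that norm, so [d^n] divides [|J| v(alpha)], i.e.
    [J] induces all shifts by multiples of [v(alpha)].  These shifts
    have finite index, and gluing over all [n] needs no compactness, since an
    automorphism of the field generated by the vertices is determined by its
    action on the tree.  Neither completion nor henselization is used. *)

Require Import Defs.
From HB Require Import structures.
From mathcomp Require Import all_boot all_order all_algebra.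
From mathcomp Require Import fingroup perm cyclic separable cyclotomic.
From mathcomp Require Import boolp classical_sets cardinality.
From mathcomp Require Import ring zify.

Set Implicit Arguments.
Unset Strict Implicit.
Unset Printing Implicit Defensive.

Import Order.TTheory GRing.Theory Num.Theory.
Local Open Scope ring_scope.

(** * Valuation rings of a field *)

Record valring (L : fieldType) := ValRing {
  vr :> {pred L};
  vr_subring : subring_closed vr;
  vr_total : forall x, x \in vr \/ x^-1 \in vr }.

HB.instance Definition _ (L : fieldType) (A : valring L) :=
  GRing.isSubringClosed.Build L (vr A) (@vr_subring L A).

Definition vmax (L : fieldType) (A : valring L) : {pred L} :=
  [pred x | (x == 0) || (x^-1 \notin A)].

Definition vunits (L : fieldType) (A : valring L) : {pred L} :=
  [pred x | [&& x != 0, x \in A & x^-1 \in A]].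

Definition vunits1 (L : fieldType) (A : valring L) : {pred L} :=
  [pred x | x - 1 \in vmax A].

Section ValuationRing.
Context (L : fieldType) (A : valring L).
Implicit Types x y : L.

Lemma vmax_vr x : x \in vmax A -> x \in A.
Proof.
rewrite inE => /orP[/eqP->|]; first exact: rpred0.
by case: (vr_total A x) => // ->.
Qed.

Lemma vmaxMr x y : x \in A -> y \in vmax A -> x * y \in vmax A.
Proof.
move=> Ax; rewrite !inE mulf_eq0.
have [->|x0] := eqVneq x 0; first by [].
have [->|y0] := eqVneq y 0; first by rewrite orbT.
move=> /= yA; apply: contra yA => xyA.
by rewrite (_ : y^-1 = x * (x * y)^-1) ?rpredM // invfM mulVKf.
Qed.

Lemma vmaxMl x y : x \in vmax A -> y \in A -> x * y \in vmax A.
Proof. by move=> *; rewrite mulrC vmaxMr. Qed.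

Lemma notin_vrV x : x \notin A -> x^-1 \in vmax A.
Proof. by move=> xA; rewrite inE invrK xA orbT. Qed.

Lemma vmax1 : 1 \notin vmax A.
Proof. by rewrite inE negb_or oner_eq0 invr1 rpred1. Qed.

(** One of the two ratios is integral, and if [z / t] is, then [z + t = (z / t + 1) * t] is an
    integral multiple of an element of the ideal. *)
Lemma vmax_zmod : zmod_closed (vmax A).
Proof.
split=> [|x y]; first by rewrite inE eqxx.
have vN z : z \in vmax A -> - z \in vmax A.
  by rewrite !inE oppr_eq0 invrN rpredN.
suff addm z t : z / t \in A -> z \in vmax A -> t \in vmax A -> z + t \in vmax A.
  move=> xm /vN ym; have [->|x0] := eqVneq x 0; first by rewrite add0r.
  case: (vr_total A (x / - y)) => [|h]; first by move/addm; apply.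
  by rewrite addrC addm //; rewrite invf_div in h.
move=> zt zm tm; have [->|t0] := eqVneq t 0; first by rewrite addr0.
have -> : z + t = (z / t + 1) * t by field.
by rewrite vmaxMr // rpredD ?rpred1.
Qed.

HB.instance Definition _ := GRing.isZmodClosed.Build L (vmax A) vmax_zmod.

Lemma vunitsP x : x \in vunits A -> [/\ x != 0, x \in A & x^-1 \in A].
Proof. by rewrite inE => /and3P. Qed.

Lemma vunitsE x : (x \in vunits A) = (x \in A) && (x \notin vmax A).
Proof. by rewrite !inE negb_or negbK andbCA. Qed.

Lemma vunits_div : divr_closed (vunits A).
Proof.
split=> [|x y /vunitsP[x0 xA xVA] /vunitsP[y0 yA yVA]].
  by rewrite inE oner_eq0 invr1 rpred1.
by rewrite inE mulf_neq0 ?invr_eq0 // rpredM //= invf_div rpredM.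
Qed.

HB.instance Definition _ := GRing.isDivClosed.Build L (vunits A) vunits_div.

Lemma vunits_neq0 x : x \in vunits A -> x != 0.
Proof. by case/vunitsP. Qed.

Lemma vunits_vr x : x \in vunits A -> x \in A.
Proof. by case/vunitsP. Qed.

Lemma vmaxMu x y : x \in vunits A -> (x * y \in vmax A) = (y \in vmax A).
Proof.
move=> /vunitsP[x0 xA xVA]; apply/idP/idP => [|/(vmaxMr xA)//].
by move/(vmaxMr xVA); rewrite mulKf.
Qed.

Lemma vunitsDm x y : x \in vunits A -> y \in vmax A -> x + y \in vunits A.
Proof.
rewrite !vunitsE => /andP[xA xm] ym.
rewrite rpredD ?(vmax_vr ym) //=.
by apply: contra xm => xym; rewrite -(addrK y x) rpredB.
Qed.

Lemma vmax_notunit x : x \in vmax A -> x \notin vunits A.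
Proof. by rewrite vunitsE => ->; rewrite andbF. Qed.

Lemma vunits1P x : x \in vunits1 A -> x \in vunits A.
Proof.
move=> x1; rewrite -[x](addrNK 1) addrC vunitsDm ?rpred1 //.
Qed.

Lemma vunits1_div : divr_closed (vunits1 A).
Proof.
split=> [|x y x1 y1]; first by rewrite inE subrr rpred0.
have [y0 yA yVA] := vunitsP (vunits1P y1).
rewrite inE (_ : x / y - 1 = ((x - 1) - (y - 1)) / y); last by field.
by rewrite vmaxMl // rpredB.
Qed.

HB.instance Definition _ := GRing.isDivClosed.Build L (vunits1 A) vunits1_div.

Lemma vrM x y : x \in A -> y \in A -> x * y \in A. Proof. exact: rpredM. Qed.
Lemma vrX n x : x \in A -> x ^+ n \in A. Proof. exact: rpredX. Qed.
Lemma vunitsM x y : x \in vunits A -> y \in vunits A -> x * y \in vunits A.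
Proof. exact: rpredM. Qed.
Lemma vunitsX n x : x \in vunits A -> x ^+ n \in vunits A. Proof. exact: rpredX. Qed.

Lemma vrXn_inv n x : (0 < n)%N -> x ^+ n \in A -> x \in A.
Proof.
move=> n0; apply: contraLR => xA.
case: n n0 => // n _; have xm := notin_vrV xA.
have : x^-1 ^+ n.+1 \in vmax A by rewrite exprS vmaxMl // rpredX // vmax_vr.
rewrite exprVn inE invrK invr_eq0 expf_eq0 /= => /orP[/eqP x0|//].
by rewrite x0 rpred0 in xA.
Qed.

Lemma vunitsXn_inv n x : (0 < n)%N -> x ^+ n \in vunits A -> x \in vunits A.
Proof.
move=> n0 /vunitsP[x0 xA xVA]; rewrite inE; apply/and3P; split.
- by apply: contra x0 => /eqP->; rewrite expf_eq0 n0 eqxx.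
- exact: vrXn_inv n0 xA.
- by apply: (vrXn_inv n0); rewrite exprVn.
Qed.

Lemma vunits_dvdn m n : (m %| n)%N -> n%:R \in vunits A -> m%:R \in vunits A.
Proof.
move=> /dvdnP[q ->]; rewrite natrM => /vunitsP[+ _ h].
rewrite mulf_eq0 negb_or => /andP[q0 m0]; rewrite inE m0 rpred_nat /=.
have -> : m%:R^-1 = q%:R * (q%:R * m%:R)^-1 :> L by rewrite invfM mulVKf.
by rewrite vrM // rpred_nat.
Qed.

Lemma vmax_prod (I : eqType) (s : seq I) (F : I -> L) :
  (\prod_(i <- s) F i) \in vmax A -> exists2 i, i \in s & F i \in vmax A.
Proof.
elim: s => [|i s IH]; first by rewrite big_nil (negPf vmax1).
rewrite big_cons; have [Fi _|Fi] := boolP (F i \in vmax A).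
  by exists i; rewrite ?mem_head.
move=> h; have FiV : (F i)^-1 \in A.
  by move: Fi; rewrite inE negb_or negbK => /andP[].
have Fi0 : F i != 0 by apply: contraNneq Fi => ->; rewrite rpred0.
have /IH[j js Fj] : \prod_(j <- s) F j \in vmax A.
  by rewrite -[X in X \in _](mulKf Fi0) vmaxMr.
by exists j => //; rewrite inE js orbT.
Qed.

Lemma geo_sum_vunits1 n r : r \in vunits1 A -> \sum_(i < n) r ^+ i - n%:R \in vmax A.
Proof.
move=> r1; have -> : n%:R = \sum_(i < n) 1 :> L by rewrite sumr_const card_ord.
by rewrite -sumrB rpred_sum // => i _; have := rpredX i r1; rewrite inE.
Qed.

(** The cofactor of [x - 1] in [x ^+ n - 1] is congruent to [n] modulo the maximal ideal, hence a
    unit and not zero. *)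
Lemma unity_vunits1 n x : n%:R \in vunits A -> x ^+ n = 1 -> x \in vunits1 A -> x = 1.
Proof.
move=> nU xn x1; apply/eqP; rewrite -subr_eq0; apply/negPn/negP => x0.
have := subrX1 x n; rewrite xn subrr => /esym/eqP; rewrite mulf_eq0 (negPf x0) /=.
move/eqP => s0; have := geo_sum_vunits1 n x1; rewrite s0 sub0r rpredN.
by move/vmax_notunit; rewrite nU.
Qed.

(** The product of the [x - w ^+ i] is [x ^+ n - 1], which lies in the maximal ideal; this ideal is
    prime, so one factor lies in it. *)
Lemma unity_approx n (w x : L) : n.-primitive_root w -> x ^+ n \in vunits1 A ->
  exists i : 'I_n, x / w ^+ i \in vunits1 A.
Proof.
move=> wn xn; have n0 := prim_order_gt0 wn.
have : (\prod_(i < n) (x - w ^+ i)) \in vmax A.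
  rewrite -(big_mkord xpredT (fun i => x - w ^+ i)).
  have /(congr1 (fun p => p.[x])) := factor_Xn_sub_1 wn.
  rewrite horner_prod !hornerE.
  under eq_bigr do rewrite hornerXsubC.
  by move=> ->; move: xn; rewrite inE.
case/vmax_prod => i _ h; exists i; rewrite inE.
have wU : w ^+ i \in vunits A.
  by apply: (@vunitsXn_inv n) => //; rewrite exprAC (prim_expr_order wn) expr1n rpred1.
have [w0 wA wVA] := vunitsP wU.
by rewrite (_ : _ - 1 = (x - w ^+ i) / w ^+ i) ?vmaxMl //; field.
Qed.

End ValuationRing.

(** * Extension of partial automorphisms *)

(** [Zorn_bigcup] also quantifies over the empty chain, whose union is empty; hence the family is
    enlarged by the empty set. If the maximal element is empty, then so is [X0], which is itself
    maximal. *)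
Lemma Zorn_above (T : Type) (P : set (set T)) (X0 : set T) : P X0 ->
  (forall F : set (set T), (exists X, F X) -> (F `<=` P)%classic ->
    total_on F subset -> P (\bigcup_(X in F) X)%classic) ->
  exists A, [/\ (X0 `<=` A)%classic, P A &
    forall B, (A `<=` B)%classic -> P B -> B = A].
Proof.
move=> PX0 chain; pose Q X := X = set0 \/ (X0 `<=` X)%classic /\ P X.
have [|A [QA maxA]] := @Zorn_bigcup T Q.
  move=> F FQ totF; have [[X [FX XN0]]|FN] := pselect (exists X, F X /\ X <> set0).
    right; split.
      have [//|[X0X _]] := FQ X FX; exact: (subset_trans X0X (bigcup_sup FX)).
    rewrite (_ : (\bigcup_(X in F) X)%classic =
        (\bigcup_(X in [set Y | F Y /\ Y <> set0]) X)%classic).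
      apply: chain.
      - by exists X.
      - by move=> Y [/FQ[//|[]]].
      - by move=> Y Z [FY _] [FZ _]; apply: totF.
    apply/seteqP; split=> t [Y]; last by case=> FY _ Yt; exists Y.
    by move=> FY Yt; exists Y => //; split=> // Y0; rewrite Y0 in Yt.
  left; apply/seteqP; split=> // t [Y FY Yt]; apply: FN; exists Y.
  by split=> // Y0; rewrite Y0 in Yt.
have maxA' B : (A `<=` B)%classic -> Q B -> B = A.
  move=> AB QB; apply: contrapT => BA; apply: (maxA B) => //; split=> // BsA.
  by apply: BA; apply/seteqP.
have [A0|[X0A PA]] := QA; last first.
  by exists A; split=> // B AB PB; apply: maxA' => //; right; split=> //; apply: subset_trans AB.
have X00 : X0 = A.
  apply: maxA'; last by right; split.
  rewrite A0; exact: sub0set.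
rewrite -X00 in maxA' *; exists X0; split=> // B AB PB; apply: maxA' => //.
by right; split.
Qed.

Section Transfer.
Context (E : fieldType) (L : closedFieldType) (i s : {rmorphism E -> L}).
Context (x : L) (p : {poly E}).
Hypothesis (p0 : p != 0) (px : root (map_poly i p) x).
Hypothesis pmin : forall q, q != 0 -> root (map_poly i q) x -> (size p <= size q)%N.

(** Minimality makes [p] coprime to every [q] not vanishing at [x], and a Bezout relation survives
    transport by [s]. The equivalence says that sending [x] to [y] is well defined and injective on
    the ring generated by [x] over [E]. *)
Lemma min_poly_transfer y : root (map_poly s p) y ->
  forall q, root (map_poly i q) x = root (map_poly s q) y.
Proof.
move=> py q; apply/idP/idP => [qx|].
  have [q0|/pmin] := eqVneq (q %% p) 0.
    by rewrite (divp_eq q p) q0 addr0 rmorphM rootM py orbT.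
  rewrite leqNgt ltn_modp p0; move=> h; have /h// : root (map_poly i (q %% p)) x.
  move: qx; rewrite {1}(divp_eq q p) rmorphD rmorphM /root hornerD hornerM.
  by rewrite (eqP px) mulr0 add0r.
apply: contraLR => qx; have : coprimep p q.
  rewrite /coprimep; have gp := dvdp_gcdl p q; have gq := dvdp_gcdr p q.
  have g0 : gcdp p q != 0 by rewrite gcdp_eq0 (negPf p0).
  have gx : ~~ root (map_poly i (gcdp p q)) x.
    apply: contra qx => gx; move/dvdpP: gq => [r ->].
    by rewrite rmorphM rootM gx orbT.
  have /dvdpP[r pr] := gp.
  have r0 : r != 0 by apply: contraNneq p0 => r0; rewrite pr r0 mul0r.
  (* The gcd does not vanish at [x], so its cofactor [r] in [p] does; minimality of [p] then forces
     the gcd to be constant. *)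
  have /(pmin r0) : root (map_poly i r) x.
    by move: px; rewrite pr rmorphM rootM (negPf gx) orbF.
  rewrite {1}pr size_mul // => h.
  have : (0 < size (gcdp p q))%N by rewrite size_poly_gt0.
  have : (0 < size r)%N by rewrite size_poly_gt0.
  move: h; set a := size (gcdp p q); set b := size r.
  case: a => [|[|k]] //; rewrite addnC; case: b => // b.
  by rewrite addSn /= leqNgt addSn ltnS leq_addl.
move/Bezout_eq1_coprimepP => [[u w] /= /(congr1 (map_poly s))].
rewrite rmorph1 rmorphD !rmorphM => /(congr1 (fun P => P.[y])).
rewrite !hornerE (eqP py) mulr0 add0r => h; apply/negP => /eqP qy.
by move: h; rewrite qy mulr0 => /esym/eqP; rewrite oner_eq0.
Qed.

End Transfer.

Lemma min_poly_exists (E L : fieldType) (i : {rmorphism E -> L}) x :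
  algebraicOver i x -> exists p : {poly E},
  [/\ p != 0, root (map_poly i p) x &
    forall q, q != 0 -> root (map_poly i q) x -> (size p <= size q)%N].
Proof.
case=> p0 p00 p0x.
pose P n := `[< exists q : {poly E}, [/\ q != 0, root (map_poly i q) x & size q = n] >].
have exP : exists n, P n by exists (size p0); apply/asboolP; exists p0.
have [n /asboolP[p [pn0 px <-]] nmin] := ex_minnP exP.
by exists p; split=> // q q0 qx; apply: nmin; apply/asboolP; exists q.
Qed.

Lemma closed_root (L : closedFieldType) (p : {poly L}) :
  (1 < size p)%N -> exists x, root p x.
Proof. by move=> p1; apply/closed_rootP; rewrite neq_ltn p1 orbT. Qed.

Section PartialAut.
Context (K : fieldType) (L : closedFieldType) (iota : {rmorphism K -> L}).

(** A graph rather than a map, so that unions of chains are immediate. Applied to differences, the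
    last clause makes the relation both functional and injective. *)
Definition partial_aut (R : set (L * L)) : Prop :=
  [/\ forall a, R (iota a, iota a),
      forall x x' y y', R (x, x') -> R (y, y') -> R (x - y, x' - y'),
      forall x x' y y', R (x, x') -> R (y, y') -> R (x * y, x' * y') &
      forall x x', R (x, x') -> (x == 0) = (x' == 0)].

Record pfield := PField {
  pf_graph :> L * L -> Prop;
  pf_aut : partial_aut pf_graph;
  pf_inv : forall x x', pf_graph (x, x') -> pf_graph (x^-1, x'^-1) }.

Definition pf_dom (R : pfield) : {pred L} := [pred x | `[< exists x', R (x, x') >]].

Lemma pf_domP (R : pfield) x : reflect (exists x', R (x, x')) (x \in pf_dom R).
Proof. by rewrite inE; apply: asboolP. Qed.

Lemma pf_dom_divring (R : pfield) : divring_closed (pf_dom R).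
Proof.
have [RK RB RM _] := pf_aut R; split.
- by apply/pf_domP; exists 1; rewrite -(rmorph1 iota).
- move=> x y /pf_domP[x' xx'] /pf_domP[y' yy']; apply/pf_domP.
  by exists (x' - y'); apply: RB.
- move=> x y /pf_domP[x' xx'] /pf_domP[y' yy']; apply/pf_domP.
  by exists (x' / y'); apply: RM => //; apply: pf_inv.
Qed.

HB.instance Definition _ R := GRing.isDivringClosed.Build L (pf_dom R) (pf_dom_divring R).

Record pf_type (R : pfield) := PFType { pf_val :> L; _ : pf_val \in pf_dom R }.

HB.instance Definition _ R := [isSub for @pf_val R].
HB.instance Definition _ R := [Choice of pf_type R by <:].
HB.instance Definition _ R := [SubChoice_isSubIntegralDomain of pf_type R by <:].
HB.instance Definition _ R := [SubIntegralDomain_isSubField of pf_type R by <:].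

Lemma pf_fun_exists R (x : pf_type R) : exists x', R (val x, x').
Proof. by case: x => x /= /pf_domP. Qed.

Definition pf_fun R (x : pf_type R) : L := projT1 (cid (pf_fun_exists x)).

Lemma pf_funP R (x : pf_type R) : R (val x, pf_fun x).
Proof. exact: projT2 (cid (pf_fun_exists x)). Qed.

Lemma partial_aut_fun (R : set (L * L)) x y z :
  partial_aut R -> R (x, y) -> R (x, z) -> y = z.
Proof.
case=> _ RB _ R0 xy xz; have := R0 _ _ (RB _ _ _ _ xy xz).
by rewrite subrr eqxx => /esym; rewrite subr_eq0 => /eqP.
Qed.

Lemma pf_fun_zmod R : zmod_morphism (@pf_fun R).
Proof.
move=> x y; have [_ RB _ _] := pf_aut R.
apply: (partial_aut_fun (pf_aut R) (pf_funP _)).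
by rewrite rmorphB; apply: RB; apply: pf_funP.
Qed.

Lemma pf_fun_monoid R : monoid_morphism (@pf_fun R).
Proof.
have [RK _ RM _] := pf_aut R; split.
  apply: (partial_aut_fun (pf_aut R) (pf_funP _)).
  by rewrite rmorph1 -(rmorph1 iota).
move=> x y; apply: (partial_aut_fun (pf_aut R) (pf_funP _)).
by rewrite rmorphM; apply: RM; apply: pf_funP.
Qed.

HB.instance Definition _ R :=
  GRing.isZmodMorphism.Build (pf_type R) L (@pf_fun R) (@pf_fun_zmod R).
HB.instance Definition _ R :=
  GRing.isMonoidMorphism.Build (pf_type R) L (@pf_fun R) (@pf_fun_monoid R).

(** This is the map induced by [s] from the ring generated by [x] to the one generated by [y]; the
    hypothesis on roots is exactly the clause on zeros. *)
Lemma poly_graph_partial_aut (E : fieldType) (i s : {rmorphism E -> L}) x y :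
  (forall a, exists c, i c = iota a /\ s c = iota a) ->
  (forall q, root (map_poly i q) x = root (map_poly s q) y) ->
  partial_aut [set z | exists q : {poly E},
     z = ((map_poly i q).[x], (map_poly s q).[y])]%classic.
Proof.
move=> iK xy; split.
- by move=> a; have [c [ic sc]] := iK a; exists c%:P; rewrite !map_polyC !hornerC /= ic sc.
- move=> ? ? ? ? [q [-> ->]] [r [-> ->]]; exists (q - r).
  by rewrite !rmorphB !hornerE.
- move=> ? ? ? ? [q [-> ->]] [r [-> ->]]; exists (q * r).
  by rewrite !rmorphM !hornerE.
- by move=> ? ? [q [-> ->]]; apply: xy.
Qed.

Hypothesis algL : forall x : L, algebraicOver iota x.

Lemma algebraic_pf (R : pfield) x : algebraicOver (val : pf_type R -> L) x.
Proof.
have [p p0 px] := algL x; have [RK _ _ _] := pf_aut R.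
have dK a : iota a \in pf_dom R by apply/pf_domP; exists (iota a).
exists (\poly_(j < size p) (PFType (dK p`_j))).
  apply: contraNneq p0 => /polyP q0; apply/eqP/polyP => j.
  have := q0 j; rewrite coef_poly !coef0; case: ltnP => [_ /(congr1 val)/=|h _].
    by move/eqP; rewrite fmorph_eq0 => /eqP.
  by rewrite nth_default.
rewrite (_ : map_poly _ _ = map_poly iota p) //.
apply/polyP => j; rewrite !coef_map_id0 ?rmorph0 // coef_poly; case: ltnP => //= h.
by rewrite nth_default // !rmorph0.
Qed.

Lemma partial_aut_maximal (R : set (L * L)) : partial_aut R ->
  exists R', [/\ (R `<=` R')%classic, partial_aut R' &
    forall S, (R' `<=` S)%classic -> partial_aut S -> S = R'].
Proof.
move=> pR; apply: Zorn_above => // F [X0 FX0] Fp totF.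
have common p q : (exists2 X, F X & X p) -> (exists2 X, F X & X q) ->
    exists X, [/\ F X, X p & X q].
  move=> [X FX Xp] [Y FY Yq]; have [XY|YX] := totF X Y FX FY.
    by exists Y; split=> //; apply: XY.
  by exists X; split=> //; apply: YX.
split.
- by move=> a; exists X0 => //; case: (Fp _ FX0).
- move=> x x' y y' xx' yy'; have [X [FX xX yX]] := common _ _ xx' yy'.
  by exists X => //; have [_ h _ _] := Fp _ FX; apply: h.
- move=> x x' y y' xx' yy'; have [X [FX xX yX]] := common _ _ xx' yy'.
  by exists X => //; have [_ _ h _] := Fp _ FX; apply: h.
- by move=> x x' [X FX xx']; have [_ _ _ h] := Fp _ FX; apply: h.
Qed.

Lemma partial_aut_fractions (R : set (L * L)) : partial_aut R ->
  partial_aut [set z | exists x x' y y', [/\ R (x, x'), R (y, y'), y != 0 &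
    z = (x / y, x' / y')]]%classic.
Proof.
case=> RK RB RM R0; have N0 y y' : R (y, y') -> y != 0 -> y' != 0.
  by move=> /R0 ->.
split.
- move=> a; exists (iota a), (iota a), 1, 1; split; rewrite ?oner_eq0 ?divr1 //.
  by rewrite -(rmorph1 iota).
- move=> ? ? ? ? [a [a' [b [b' [aa' bb' b0 [-> ->]]]]]] [c [c' [d [d' [cc' dd' d0 [-> ->]]]]]].
  exists (a * d - c * b), (a' * d' - c' * b'), (b * d), (b' * d').
  have b'0 := N0 _ _ bb' b0; have d'0 := N0 _ _ dd' d0.
  split; rewrite ?mulf_neq0 //; [by apply: RB; apply: RM|by apply: RM|].
  by congr pair; field; apply/andP.
- move=> ? ? ? ? [a [a' [b [b' [aa' bb' b0 [-> ->]]]]]] [c [c' [d [d' [cc' dd' d0 [-> ->]]]]]].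
  exists (a * c), (a' * c'), (b * d), (b' * d').
  have b'0 := N0 _ _ bb' b0; have d'0 := N0 _ _ dd' d0.
  split; rewrite ?mulf_neq0 //; [by apply: RM|by apply: RM|].
  by congr pair; field; apply/andP.
- move=> ? ? [a [a' [b [b' [aa' bb' b0 [-> ->]]]]]].
  by rewrite !mulf_eq0 !invr_eq0 (negPf b0) (negPf (N0 _ _ bb' b0)) !orbF (R0 _ _ aa').
Qed.

Theorem partial_aut_extend (R : set (L * L)) : partial_aut R ->
  exists s : galois iota, forall x y, R (x, y) -> s x = y.
Proof.
move=> /partial_aut_maximal[M [RM pM maxM]].
have [MK MB MM M0] := pM.
have M1 : M (1, 1) by rewrite -(rmorph1 iota).
have Minv x x' : M (x, x') -> M (x^-1, x'^-1).
  move=> xx'; have [x0|x0] := eqVneq x 0.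
    have := M0 _ _ xx'; rewrite x0 eqxx => /esym/eqP ->; rewrite invr0.
    by rewrite -(rmorph0 iota).
  rewrite -(maxM _ _ (partial_aut_fractions pM)); last first.
    move=> [y y'] yy'; exists y, y', 1, 1; split; rewrite ?oner_eq0 ?divr1 //.
  by exists 1, 1, x, x'; split; rewrite ?div1r.
pose P := PField pM Minv.
(* Sending [x] to a root of the transported minimal polynomial extends [M], so by maximality [x]
   already has an image. *)
have Mtot x : exists y, M (x, y).
  have [p [p0 px pmin]] := min_poly_exists (algebraic_pf P x).
  have [|y py] := @closed_root L (map_poly (@pf_fun P) p).
    rewrite size_map_poly; rewrite -(size_map_poly (val : pf_type P -> L)).
    by apply: root_size_gt1 px; rewrite map_poly_eq0.
  have tr := min_poly_transfer p0 px pmin py.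
  have funval a (h : a \in pf_dom P) a' : M (a, a') -> pf_fun (PFType h) = a'.
    by move=> aa'; apply: (partial_aut_fun pM _ aa'); apply: (pf_funP (PFType h)).
  exists y; rewrite -(maxM _ _ (poly_graph_partial_aut _ tr)).
  - by exists 'X; rewrite !map_polyX !hornerX.
  - move=> [a a'] aa'; have h : a \in pf_dom P by apply/pf_domP; exists a'.
    exists (PFType h)%:P; rewrite !map_polyC !hornerC /=.
    by rewrite (funval _ h _ aa').
  - move=> a; have h : iota a \in pf_dom P by apply/pf_domP; exists (iota a).
    by exists (PFType h); split=> //; apply: (funval _ h).
pose s x := projT1 (cid (Mtot x)).
have sP x : M (x, s x) by apply: projT2 (cid (Mtot x)).
have sE x y : M (x, y) -> s x = y by apply: partial_aut_fun.
have sB : zmod_morphism s by move=> x y; apply: sE; apply: MB.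
have sM : monoid_morphism s.
  by split=> [|x y]; apply: sE => //; apply: MM.
pose S0 : {rmorphism L -> L} := HB.pack s
  (GRing.isZmodMorphism.Build L L s sB) (GRing.isMonoidMorphism.Build L L s sM).
have [S Ss] : exists S : {rmorphism L -> L}, S =1 s by exists S0.
have SK a : S (iota a) = iota a by rewrite Ss; apply: sE.
(* [S] maps the finite root set of a polynomial over [K] injectively into itself, hence onto. *)
have Ssurj y : exists x, S x = y.
  have [p p0 py] := algL y; pose q := map_poly iota p.
  have q0 : q != 0 by rewrite map_poly_eq0.
  have [rs qrs] := closed_field_poly_normal q.
  pose t := undup rs.
  have tE z : (z \in t) = root q z.
    by rewrite mem_undup qrs rootZ ?lead_coef_eq0 // root_prod_XsubC.
  have Sq z : root q z -> root q (S z).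
    rewrite /root => /eqP qz; have := horner_map S q z; rewrite qz rmorph0 => /eqP.
    by rewrite -map_poly_comp (eq_map_poly (g := iota)).
  have St : {subset map S t <= t}.
    by move=> z /mapP[u]; rewrite tE => /Sq qu ->; rewrite tE.
  have /mapP[x _ ->] : y \in map S t.
    have uS : uniq (map S t) by rewrite map_inj_uniq ?undup_uniq //; apply: fmorph_inj.
    by rewrite (uniq_min_size uS St (eq_leq (esym (size_map _ _)))).2 tE.
  by exists x.
pose S' y := projT1 (cid (Ssurj y)).
have S'K : cancel S' S by move=> y; apply: projT2 (cid (Ssurj y)).
have SK' : cancel S S' by move=> x; apply: (fmorph_inj S); rewrite S'K.
by exists (Galois SK' S'K SK) => x y /RM /sE <- /=.
Qed.

Hypothesis charK : [pchar K] =i pred0.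

(** In characteristic zero [x] is a simple root of its minimal polynomial; let [q] be the cofactor
    of the linear factor. If [q] is constant, the minimal polynomial is linear. Otherwise [q] has a
    root [y] other than [x], and some automorphism sends [x] to [y]. *)
Theorem galois_fixed x : (forall s : galois iota, s x = x) -> exists a, x = iota a.
Proof.
move=> fixx; have [p [p0 px pmin]] := min_poly_exists (algL x).
have := px; rewrite -dvdp_XsubCl => /dvdpP[q pq].
have p1 : (1 < size p)%N.
  by rewrite -(size_map_poly iota); apply: root_size_gt1 px; rewrite map_poly_eq0.
have dp0 : p^`() != 0.
  apply/eqP => /polyP/(_ (size p).-2); rewrite coef_deriv coef0.
  case sp: (size p) p1 => [|[|n]] //= _.
  have := lead_coef_eq0 p; rewrite (negPf p0) lead_coefE sp /= => pn.
  move/eqP; rewrite -mulr_natr mulf_eq0 pn /= => n0.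
  by have [c] := natf0_pchar (ltn0Sn n) n0; rewrite charK.
have dpx : ~~ root (map_poly iota p^`()) x.
  by apply/negP => /(pmin _ dp0); rewrite leqNgt lt_size_deriv.
have qx : ~~ root q x.
  apply: contra dpx; rewrite -deriv_map pq derivM derivXsubC mulr1 /root => /eqP qx.
  by rewrite !hornerE subrr mulr0 add0r qx.
have q0 : q != 0 by apply: contraNneq qx => ->; rewrite root0.
case sq : (size q) => [|[|n]]; first by move: q0; rewrite -size_poly_gt0 sq.
  have spE : size p = 2.
    by rewrite -(size_map_poly iota) pq size_mul ?polyXsubC_eq0 // size_XsubC sq.
  exists (- p`_0 / p`_1).
  have p10 : p`_1 != 0 by move: p0; rewrite -lead_coef_eq0 lead_coefE spE.
  have := px; rewrite /root horner_coef size_map_poly spE !big_ord_recl big_ord0.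
  rewrite !coef_map /= expr0 expr1 mulr1 addr0 rmorphM rmorphN fmorphV => /eqP h.
  have i10 : iota p`_1 != 0 by rewrite fmorph_eq0.
  apply: (mulfI i10); rewrite mulrCA mulfV // mulr1.
  by move/eqP: h; rewrite addrC addr_eq0 => /eqP.
have [y qy] := @closed_root L q (etrans (congr1 _ sq) erefl).
have py : root (map_poly iota p) y by rewrite pq rootM qy.
have yx : y != x by apply: contraNneq qx => <-.
have tr := min_poly_transfer p0 px pmin py.
have [//|s ss] := partial_aut_extend (poly_graph_partial_aut _ tr).
  by move=> a; exists a.
case/eqP: yx; rewrite -(fixx s); symmetry; apply: ss; exists 'X.
by rewrite !map_polyX !hornerX.
Qed.

End PartialAut.

(** * Extension of the valuation *)

Section DiscreteValuation.
Context (K : fieldType) (v : discrete_valuation K).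
Implicit Types x y : K.

Lemma dval1 : v 1 = 0.
Proof.
by have /eqP := dvalM v (oner_neq0 K) (oner_neq0 K); rewrite mulr1 -subr_eq subrr => /eqP.
Qed.

Lemma dvalX x n : x != 0 -> v (x ^+ n) = v x * n%:Z.
Proof.
move=> x0; elim: n => [|n IH]; first by rewrite dval1 mulr0.
by rewrite exprS dvalM ?expf_neq0 // IH intS mulrDr mulr1.
Qed.

Lemma dvalV x : x != 0 -> v x^-1 = - v x.
Proof.
move=> x0; apply/eqP; rewrite -addr_eq0 -dvalM ?invr_eq0 //.
by rewrite mulVf ?dval1.
Qed.

Lemma dvalN x : v (- x) = v x.
Proof.
have [->|x0] := eqVneq x 0; first by rewrite oppr0.
have N1 : v (-1) = 0.
  have n0 : (-1 : K) != 0 by rewrite oppr_eq0 oner_neq0.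
  by have := dvalX 2 n0; rewrite sqrrN expr1n dval1 => /esym/eqP; rewrite mulf_eq0 orbF => /eqP.
by rewrite -mulN1r dvalM ?N1 ?add0r // oppr_eq0 oner_neq0.
Qed.

Lemma vringE x : x != 0 -> (x \in vring v) = (0 <= v x).
Proof. by move=> x0; rewrite inE (negPf x0). Qed.

Lemma vring_subring : subring_closed (vring v).
Proof.
split=> [|x y|x y].
  by rewrite vringE ?oner_neq0 // dval1.
- have [->|y0] := eqVneq y 0; first by rewrite subr0.
  have [->|x0] := eqVneq x 0; first by move=> _; rewrite sub0r !vringE ?dvalN ?oppr_eq0.
  have [->|xy0] := eqVneq (x - y) 0; first by move=> _ _; rewrite inE eqxx.
  rewrite !vringE // => vx vy; apply: le_trans (dvalD v x0 _ xy0); last by rewrite oppr_eq0.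
  by rewrite dvalN le_min vx vy.
- have [->|y0] := eqVneq y 0; first by rewrite mulr0.
  have [->|x0] := eqVneq x 0; first by rewrite mul0r.
  by rewrite !vringE ?mulf_neq0 // dvalM // => *; apply: addr_ge0.
Qed.

Lemma dval_pos_exists : exists2 x, x != 0 & 0 < v x.
Proof.
have [x x0 vx] := dval_nontrivial v; have [h|h] := ltP 0 (v x); first by exists x.
by exists x^-1; rewrite ?invr_eq0 // dvalV // oppr_gt0 lt_neqAle vx.
Qed.

End DiscreteValuation.

(* A subring that is maximal among those not containing [p^-1] is a valuation
   ring, by the argument of Chevalley's theorem. *)
Section MaximalSubring.
Context (L : fieldType) (R : subringClosed L) (p : L).
Hypotheses (pR : p \in R) (pV : p^-1 \notin R).
Hypothesis maxR : forall S : {pred L}, subring_closed S -> {subset R <= S} ->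
  p^-1 \notin S -> {subset S <= R}.

Let p0 : p != 0.
Proof. by apply: contraNneq pV => ->; rewrite invr0 rpred0. Qed.

(** The inverse of [u] can be adjoined without reaching [p^-1]: as [u ^+ k] is 1 modulo [p], having
    [p^-1 * u ^+ k] in [R] would put [p^-1] in [R]. Maximality then applies. *)
Lemma maximal_subring_unit t : t \in R -> (1 + p * t)^-1 \in R.
Proof.
move=> tR; set u := 1 + p * t.
have ptR : p * t \in R by rewrite rpredM.
have uR : u \in R by rewrite rpredD ?rpred1.
have u0 : u != 0.
  apply: contraNneq pV => /eqP; rewrite /u addrC addr_eq0 => /eqP pt.
  by rewrite -[p^-1]mulr1 -[1]opprK -pt -mulrN mulKf // rpredN.
pose S : {pred L} := [pred x | `[< exists2 k, u ^+ k != 0 & x * u ^+ k \in R >]].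
have SP x k : x * u ^+ k \in R -> x \in S.
  by move=> h; rewrite inE; exists k; rewrite ?expf_neq0.
have SI x : x \in S -> exists k, x * u ^+ k \in R by rewrite inE => -[k _ ?]; exists k.
apply: (maxR (S := S)); last by apply: (SP _ 1); rewrite expr1 mulVf ?rpred1.
- split; first by apply: (SP _ 0); rewrite expr0 mulr1 rpred1.
  + move=> x y /SI[k xk] /SI[l yl].
    apply: (SP _ (k + l)%N); rewrite mulrBl {2}addnC !exprD !mulrA.
    by rewrite rpredB // rpredM // rpredX.
  + move=> x y /SI[k xk] /SI[l yl].
    by apply: (SP _ (k + l)%N); rewrite exprD mulrACA rpredM.
- by move=> x xR; apply: (SP _ 0); rewrite expr0 mulr1.
- apply/negP => /SI[k h]; case/negP: pV.
  have u1 : u - 1 = p * t by rewrite /u addrC addKr.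
  have := subrX1 u k; rewrite u1 => /eqP; rewrite subr_eq => /eqP uk.
  have -> : p^-1 = p^-1 * u ^+ k - t * (\sum_(i < k) u ^+ i).
    by rewrite uk -!mulrA mulrDr mulKf // mulr1 [X in X - _]addrC addrK.
  by rewrite rpredB // rpredM // rpred_sum // => i _; rewrite rpredX.
Qed.

Lemma maximal_subring_poly x : x \notin R ->
  exists2 q, q \is a polyOver R & p * q.[x] = 1.
Proof.
move=> xR; pose S : {pred L} := [pred y | `[< exists2 q, q \is a polyOver R & q.[x] = y >]].
have SP q : q \is a polyOver R -> q.[x] \in S.
  by move=> qR; rewrite inE; exists q.
have SI y : y \in S -> exists2 q, q \is a polyOver R & q.[x] = y by rewrite inE.
have [|pS] := boolP (p^-1 \in S).
  by move/SI=> [q qR qx]; exists q; rewrite // qx mulfV.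
case/negP: xR; apply: (maxR _ _ pS).
- split.
  + by rewrite -(hornerC 1 x) SP // polyOverC rpred1.
  + move=> y z /SI[q qR <-] /SI[r rR <-].
    by rewrite -hornerN -hornerD SP ?rpredB.
  + move=> y z /SI[q qR <-] /SI[r rR <-].
    by rewrite -hornerM SP ?rpredM.
- by move=> y yR; rewrite -(hornerC y x) SP // polyOverC.
- by rewrite -[X in X \in _](hornerX x) SP // polyOverX.
Qed.

Let rep x n := exists q, [/\ q \is a polyOver R, (size q <= n.+1)%N & p * q.[x] = 1].

(* The relation for [x^-1] expresses the top power of [x] by lower ones. *)
Lemma rep_reduce x n : x != 0 -> rep x n.+1 -> rep x^-1 n.+1 -> rep x n.
Proof.
move=> x0 [q [qR sq qx]] [r [rR sr rx]].
have rc j : r`_j \in R by apply/polyOverP.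
have qc j : q`_j \in R by apply/polyOverP.
set u := 1 - p * r`_0.
have uV : u^-1 \in R by rewrite /u -mulrN maximal_subring_unit ?rpredN.
have u0 : u != 0.
  rewrite subr_eq0; apply: contra pV => /eqP pr.
  by rewrite -[p^-1]mulr1 pr mulKf.
pose s := \poly_(j < n.+1) (u^-1 * r`_(n.+1 - j)).
have sR : s \is a polyOver R.
  by apply/polyOverP => j; rewrite coef_poly; case: ifP => // _; rewrite ?rpredM ?rpred0.
have xs : x ^+ n.+1 = p * s.[x].
  apply: (mulfI u0); rewrite horner_poly.
  transitivity (p * \sum_(j < n.+1) r`_(n.+1 - j) * x ^+ j); last first.
    rewrite !mulr_sumr; apply: eq_bigr => j _.
    by rewrite [RHS]mulrCA -[_ * x ^+ j in RHS]mulrA mulVKf.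
  have h : p * (\sum_(j < n.+1) r`_j.+1 * x^-1 ^+ j.+1) = u.
    rewrite /u -rx (horner_coef_wide _ sr) [X in p * X - _]big_ord_recl /= expr0 mulr1.
    by rewrite mulrDr [_ + p * _]addrC addrK.
  rewrite -h -mulrA; congr (_ * _); rewrite mulr_suml (reindex_inj rev_ord_inj) /=.
  apply: eq_bigr => j _; rewrite -mulrA subSS -subSn ?leq_ord //; congr (_ * _).
  by rewrite -[X in _ * x ^+ X](subnK (ltnW (ltn_ord j))) exprD mulrA -exprMn mulVf // expr1n mul1r.
exists (q - q`_n.+1 *: 'X^(n.+1) + (p * q`_n.+1) *: s); split.
- by rewrite rpredD ?rpredB // polyOverZ ?rpredM // ?polyOverXn.
- apply/leq_sizeP => j nj; rewrite coefD coefB !coefZ coefXn coef_poly ltnNge nj /= mulr0 addr0.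
  have [->|jn] := eqVneq j n.+1; first by rewrite mulr1 subrr.
  by rewrite mulr0 subr0 nth_default // (leq_trans sq) // ltn_neqAle eq_sym jn.
- by rewrite !hornerE xs -[RHS]qx; ring.
Qed.

(** Descent on [n + m]: after exchanging [x] and [x^-1] if needed, the relation with the larger
    bound is shortened by [rep_reduce], the other bound being weakened to match. With both bounds
    zero, [p^-1] would lie in [R]. *)
Lemma rep_absurd x n m : x != 0 -> rep x n -> rep x^-1 m -> False.
Proof.
elim: {n m}(n + m)%N {-2}n {-2}m (leqnn (n + m)) x => [|k IH] n m nmk x x0 xn xm.
  move: nmk xn; rewrite leqn0 addn_eq0 => /andP[/eqP-> _] [q [/polyOverP qR sq]].
  rewrite (horner_coef_wide _ sq) big_ord1 expr0 mulr1 => h.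
  by case/negP: pV; rewrite -[p^-1]mulr1 -h mulKf.
wlog mn : x x0 n m nmk xn xm / (m <= n)%N.
  move=> W; have [mn|/ltnW nm] := leqP m n; first by apply: (W x x0 n m).
  by apply: (W x^-1 _ m n); rewrite ?invr_eq0 ?invrK // addnC.
have [n0|n0] := posnP n.
  by apply: (IH n m _ x) => //; move: mn; rewrite n0 leqn0 => /eqP->.
case: n n0 nmk xn mn => // n _ nmk xn mn.
have xm' : rep x^-1 n.+1.
  by case: xm => r [rR sr rx]; exists r; split=> //; apply: leq_trans sr _.
by apply: (IH n m _ x) => //; apply: rep_reduce.
Qed.

Lemma maximal_subring_total x : x \in R \/ x^-1 \in R.
Proof.
have [xR|xR] := boolP (x \in R); [by left|right].
have x0 : x != 0 by apply: contraNneq xR => ->; rewrite rpred0.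
apply/negPn/negP => xVR.
have [q qR qx] := maximal_subring_poly xR.
have [r rR rx] := maximal_subring_poly xVR.
by apply: (@rep_absurd x (size q) (size r) x0); [exists q|exists r].
Qed.

End MaximalSubring.

Section Extension.
Context (K : fieldType) (v : discrete_valuation K).
Context (L : fieldType) (iota : {rmorphism K -> L}).

(** [A] is a subring maximal among those that contain the image of the valuation ring of [K] and
    miss the image of [w^-1], where [v w > 0]. *)
Theorem valuation_extension :
  exists A : valring L, forall a, (iota a \in A) = (a \in vring v).
Proof.
have [w w0 vw] := dval_pos_exists v.
pose P (X : set L) := [/\ subring_closed (mem X), forall a, a \in vring v -> X (iota a) &
  ~ X (iota w^-1)].
pose X0 := [set x | exists2 a, a \in vring v & x = iota a]%classic.
have [vr1 vrB vrM] := vring_subring v.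
have PX0 : P X0.
  split.
  - split=> [|x y|x y]; rewrite !in_setE.
    + by exists 1; rewrite ?rmorph1.
    + by move=> [a aR ->] [b bR ->]; exists (a - b); rewrite ?rmorphB ?vrB.
    + by move=> [a aR ->] [b bR ->]; exists (a * b); rewrite ?rmorphM ?vrM.
  - by move=> a aR; exists a.
  - move=> [a aR /fmorph_inj wa]; move: aR.
    by rewrite -wa vringE ?invr_eq0 // dvalV // leNgt oppr_lt0 vw.
have [F [X FX] FP totF|R [RX PR maxR]] := Zorn_above PX0.
  have common p q : (exists2 X, F X & X p) -> (exists2 X, F X & X q) ->
      exists X, [/\ F X, X p & X q].
    move=> [Y FY Yp] [Z FZ Zq]; have [YZ|ZY] := totF Y Z FY FZ.
      by exists Z; split=> //; apply: YZ.
    by exists Y; split=> //; apply: ZY.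
  split.
  - split=> [|x y|x y]; rewrite !in_setE.
    + by exists X => //; have [[]] := FP X FX; rewrite in_setE.
    + move=> xF yF; have [Y [FY Yx Yy]] := common _ _ xF yF; exists Y => //.
      by have [[_ h _] _ _] := FP Y FY; move: (h x y); rewrite !in_setE; apply.
    + move=> xF yF; have [Y [FY Yx Yy]] := common _ _ xF yF; exists Y => //.
      by have [[_ _ h] _ _] := FP Y FY; move: (h x y); rewrite !in_setE; apply.
  - by move=> a aR; exists X => //; have [_ h _] := FP X FX; apply: h.
  - by move=> [Y FY]; have [_ _] := FP Y FY.
have [subR RK wR] := PR.
have wmem : iota w \in mem R by rewrite in_setE; apply: RK; rewrite vringE // ltW.
have wN : (iota w)^-1 \notin mem R by apply/negP; rewrite -fmorphV in_setE.
have max' (S : {pred L}) : subring_closed S -> {subset mem R <= S} ->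
    (iota w)^-1 \notin S -> {subset S <= mem R}.
  move=> subS RS wS; pose S' := [set x | x \in S]%classic.
  have S'E x : (x \in S') = (x \in S) by apply/idP/idP; rewrite in_setE.
  have -> : R = S'.
    apply/esym/maxR; first by move=> x; rewrite -in_setE => /RS.
    split.
    - case: subS => h1 hB hM; split=> [|x y|x y]; rewrite !S'E //.
        exact: hB.
      exact: hM.
    - by move=> a /RK; rewrite -in_setE => /RS.
    - by rewrite fmorphV; apply/negP.
  by move=> x; rewrite S'E.
pose RR : subringClosed L := HB.pack (fun x => x \in R)
  (GRing.isSubringClosed.Build L (fun x => x \in R) subR).
exists (ValRing subR (@maximal_subring_total L RR _ wmem wN max')) => a /=.
apply/idP/idP => [|aR]; last by rewrite in_setE; apply: RK.
apply: contraLR => aR; have a0 : a != 0 by apply: contraNneq aR => ->; rewrite inE eqxx.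
move: aR; rewrite vringE // -ltNge => va.
(* With these exponents [a ^+ s * w ^+ t] has value 0, so its inverse is integral, and [iota a] in
   [R] would put the inverse of [iota w] in [R]. This uses that values are integers. *)
pose s := `|v w|%N; pose t := `|v a|%N.
have bR : (a ^+ s * w ^+ t)^-1 \in vring v.
  rewrite vringE ?invr_eq0 ?mulf_neq0 ?expf_neq0 // dvalV ?mulf_neq0 ?expf_neq0 //.
  rewrite dvalM ?expf_neq0 // !dvalX // /s /t.
  by rewrite (gtz0_abs vw) (ltz0_abs va) mulrN [v w * _]mulrC subrr oppr0.
have t0 : (0 < t)%N by rewrite absz_gt0 lt_eqF.
apply/negP => aRR; case/negP: wN.
have -> : (iota w)^-1 = iota a ^+ s * iota (a ^+ s * w ^+ t)^-1 * iota w ^+ t.-1.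
  rewrite -!rmorphXn -!rmorphM -fmorphV; congr (iota _).
  rewrite -[X in (_ * w ^+ X)^-1](prednK t0) exprS.
  by field; rewrite !expf_neq0 // w0.
have wRX : iota w ^+ t.-1 \in mem R.
  by rewrite -rmorphXn in_setE; apply: RK; rewrite vringE ?expf_neq0 // dvalX // mulr_ge0 // ltW.
have [_ _ RM] := subR; have [R1 _ _] := subR.
apply: (RM _ _ _ wRX); apply: (RM); last by rewrite in_setE; apply: RK.
by elim: s {bR} => [|s IH]; rewrite ?expr0 // exprS; apply: (RM).
Qed.

End Extension.

(** * Sizes of elements of [L] compared with those of [K] *)

Section ExtendedValuation.
Context (K : fieldType) (v : discrete_valuation K).
Context (L : fieldType) (iota : {rmorphism K -> L}).
Context (A : valring L).
Hypothesis AK : forall a, (iota a \in A) = (a \in vring v).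
Hypothesis algL : forall x : L, algebraicOver iota x.

Lemma vunits_iota a : (iota a \in vunits A) = (a != 0) && (v a == 0).
Proof.
rewrite inE fmorph_eq0 -fmorphV !AK; have [//|a0] := eqVneq a 0.
by rewrite !vringE ?invr_eq0 // dvalV // oppr_ge0 /= eq_le andbC.
Qed.

Lemma vmax_iota a : (iota a \in vmax A) = (a == 0) || (0 < v a).
Proof.
rewrite inE fmorph_eq0 -fmorphV AK; have [//|a0] := eqVneq a 0.
by rewrite vringE ?invr_eq0 // dvalV // oppr_ge0 ltNge.
Qed.

Lemma dominant_term (I : eqType) (F : I -> L) (s : seq I) :
  has (fun i => F i != 0) s ->
  exists2 k, k \in s & F k != 0 /\ forall i, i \in s -> F i / F k \in A.
Proof.
elim: s => [//|i s IH] /=.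
have [hs _|/hasPn s0] := boolP (has (fun i => F i != 0) s); last first.
  rewrite orbF => Fi.
  exists i; rewrite ?mem_head //; split=> // j; rewrite inE => /predU1P[->|/s0].
    by rewrite mulfV ?rpred1.
  by rewrite negbK => /eqP->; rewrite mul0r rpred0.
have [k ks [Fk Fs]] := IH hs.
have [ik|ki] := vr_total A (F i / F k).
  exists k; rewrite ?inE ?ks ?orbT //; split=> // j; rewrite inE => /predU1P[->//|].
  exact: Fs.
have [Fi|Fi] := eqVneq (F i) 0.
  exists k; rewrite ?inE ?ks ?orbT //; split=> // j; rewrite inE => /predU1P[->|].
    by rewrite Fi mul0r rpred0.
  exact: Fs.
exists i; rewrite ?mem_head //; split=> // j; rewrite inE => /predU1P[->|js].
  by rewrite mulfV ?rpred1.
rewrite invf_div in ki.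
have -> : F j / F i = F j / F k * (F k / F i) by rewrite mulrA divfK.
exact: rpredM (Fs j js) ki.
Qed.

(** Divide by a term of greatest size. Were all other quotients in the maximal ideal, the vanishing
    sum would put -1 there. *)
Lemma zero_sum_same_size n (F : 'I_n -> L) : \sum_i F i = 0 -> (exists i, F i != 0) ->
  exists i j : 'I_n, [/\ (i < j)%N, F i != 0, F j != 0 & F i / F j \in vunits A].
Proof.
move=> F0 [i0 Fi0].
have [|k _ [Fk kmax]] := @dominant_term _ F (enum 'I_n).
  by apply/hasP; exists i0; rewrite ?mem_enum.
have kA i : F i / F k \in A by apply: kmax; rewrite mem_enum.
have [j jk jm] : exists2 j, j != k & F j / F k \notin vmax A.
  apply: contrapT => no; have: (- 1 : L) \in vmax A; last by rewrite rpredN (negPf (vmax1 A)).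
  have : \sum_i F i / F k = 0 by rewrite -mulr_suml F0 mul0r.
  rewrite (bigD1 k) //= mulfV // addrC => /eqP; rewrite addr_eq0 => /eqP <-.
  apply: rpred_sum => i ik; apply/negPn/negP => im; apply: no; by exists i.
have jU : F j / F k \in vunits A by rewrite vunitsE kA.
have Fj : F j != 0 by apply: contraNneq jm => ->; rewrite mul0r rpred0.
have [jk'|kj|e] := ltngtP j k; first by exists j, k.
  by exists k, j; split=> //; rewrite -invf_div rpredV.
by rewrite (val_inj e) eqxx in jk.
Qed.

(** Two terms of an algebraic equation for [x] have the same size, and their quotient is a power of
    [x] times a constant from [K]. Thus the value group of [A] is torsion over that of [K]; this
    replaces a value function on [L]. *)
Lemma power_approx x : x != 0 -> exists n c,
  [/\ (0 < n)%N, c != 0 & x ^+ n / iota c \in vunits A].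
Proof.
move=> x0; have [p p0 px] := algL x.
have [||i [j [ij Fi Fj U]]] := @zero_sum_same_size (size p) (fun i => iota p`_i * x ^+ i).
- move/rootP: px; rewrite horner_coef size_map_poly => {2}<-.
  by apply: eq_bigr => i _; rewrite coef_map.
- have sp : (0 < size p)%N by rewrite size_poly_gt0.
  have lt : ((size p).-1 < size p)%N by rewrite prednK.
  by exists (Ordinal lt); rewrite mulf_neq0 ?expf_neq0 // fmorph_eq0 -lead_coefE lead_coef_eq0.
have nz (k : 'I_(size p)) : iota p`_k * x ^+ k != 0 -> p`_k != 0 /\ iota p`_k != 0.
  by rewrite mulf_eq0 negb_or => /andP[pk _]; split; rewrite ?pk // -(fmorph_eq0 iota).
have [pi0 ipi0] := nz i Fi; have [pj0 ipj0] := nz j Fj.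
exists (j - i)%N, (p`_i / p`_j); split; rewrite ?subn_gt0 // ?mulf_neq0 ?invr_eq0 //.
have xjE : x ^+ j = x ^+ (j - i) * x ^+ i by rewrite -exprD subnK // ltnW.
have xi : x ^+ i != 0 by rewrite expf_neq0.
have xj : x ^+ (j - i) != 0 by rewrite expf_neq0.
have -> : x ^+ (j - i) / iota (p`_i / p`_j) = (iota p`_i * x ^+ i / (iota p`_j * x ^+ j))^-1.
  by rewrite xjE fmorph_div; field; rewrite ipj0 ipi0 xj xi.
by rewrite rpredV.
Qed.

(** [A] has rank one: by [power_approx], suitable powers of [x] and [s] have the sizes of elements
    of [K], whose values are integers. *)
Lemma vmax_power x s : x \in vmax A ->
  exists M, forall k, (M <= k)%N -> x ^+ k * s \in vmax A.
Proof.
move=> xm; have [->|s0] := eqVneq s 0; first by exists 0 => k _; rewrite mulr0 rpred0.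
have [->|x0] := eqVneq x 0.
  by exists 1 => k k0; rewrite expr0n eqn0Ngt k0 mul0r rpred0.
have [n [c [n0 c0 xc]]] := power_approx x0; have [l [e [l0 e0 se]]] := power_approx s0.
have vc : 0 < v c.
  suff: iota c \in vmax A by rewrite vmax_iota (negPf c0).
  have : x ^+ n \in vmax A.
    by case: n n0 {xc} => // n _; rewrite exprS vmaxMl // rpredX // vmax_vr.
  have ic0 : iota c != 0 by rewrite fmorph_eq0.
  by rewrite -[X in X \in _](divfK ic0) vmaxMu.
(* Up to a unit, [(x ^+ k * s) ^+ (n * l)] is the image of [c ^+ (k * l) * e ^+ n], whose value is
   positive once [k * l] exceeds [n * |v e|], because [v c >= 1]. *)
exists (n * `|v e|).+1 => k kM.
have nl : (0 < n * l)%N by rewrite muln_gt0 n0.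
suff: (x ^+ k * s) ^+ (n * l) \in vmax A.
  apply: contraLR => zm; have [z0 zV] : x ^+ k * s != 0 /\ (x ^+ k * s)^-1 \in A.
    by move: zm; rewrite inE negb_or negbK => /andP[].
  by rewrite inE expf_eq0 (negPf z0) andbF /= negbK -exprVn rpredX.
have -> : (x ^+ k * s) ^+ (n * l) =
    (x ^+ n / iota c) ^+ (k * l) * (s ^+ l / iota e) ^+ n * iota (c ^+ (k * l) * e ^+ n).
  rewrite rmorphM !rmorphXn !exprMn !exprVn -!exprM.
  rewrite [(l * n)%N]mulnC [(n * (k * l))%N]mulnCA.
  by field; rewrite !expf_neq0 ?fmorph_eq0.
rewrite vmaxMu; last by rewrite rpredM ?(rpredX _ xc) ?(rpredX _ se).
rewrite vmax_iota mulf_eq0 !expf_eq0 (negPf c0) (negPf e0) !andbF /=.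
rewrite dvalM ?expf_neq0 // !dvalX //.
have : (n * `|v e| < k * l)%N by apply: leq_trans kM _; rewrite leq_pmulr.
move: (k * l)%N vc => m vc; nia.
Qed.

End ExtendedValuation.

(** * Decomposition groups at a finite level *)

Section GaloisGroup.
Context (K : fieldType) (L : closedFieldType) (iota : {rmorphism K -> L}).
Implicit Types s t : galois iota.

Lemma gal_id_exists : exists s, forall x : L, s x = x.
Proof.
by exists (@Galois K L iota idfun id (fun=> erefl) (fun=> erefl) (fun=> erefl)).
Qed.

Lemma gal_comp_exists s t : exists r : galois iota, forall x : L, r x = s (t x).
Proof.
have cK : cancel (s \o t) (gal_inv t \o gal_inv s) by move=> x; rewrite /= !gal_funK.
have cK' : cancel (gal_inv t \o gal_inv s) (s \o t) by move=> x; rewrite /= !gal_invK.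
have cF a : (s \o t) (iota a) = iota a by rewrite /= !gal_fix.
by exists (@Galois K L iota (s \o t) _ cK cK' cF).
Qed.

End GaloisGroup.

Lemma uniform_bound (T : finType) (P : T -> nat -> Prop) :
  (forall x, exists M, forall k, (M <= k)%N -> P x k) ->
  exists M, forall x k, (M <= k)%N -> P x k.
Proof.
move=> /choice[M MP]; exists (\max_x M x) => x k Mk.
by apply: MP; apply: leq_trans Mk; apply: leq_bigmax.
Qed.

Section FiniteLevel.
Context (K : fieldType) (L : closedFieldType) (iota : {rmorphism K -> L}).
Context (X : seq L).
Hypothesis stabX : forall (s : galois iota) x, x \in X -> s x \in X.
Implicit Types s t : galois iota.

Definition fin_act s (x : seq_sub X) : seq_sub X := SeqSub (stabX s (valP x)).

Lemma fin_act_inj s : injective (fin_act s).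
Proof. by move=> x y /(congr1 val)/= /fmorph_inj/val_inj. Qed.

Definition gperm s : {perm seq_sub X} := perm (@fin_act_inj s).

Lemma gpermE s x : val (gperm s x) = s (val x).
Proof. by rewrite permE. Qed.

Lemma gperm_eqP s t : gperm s = gperm t <-> {in X, s =1 t}.
Proof.
split=> [st x xX|st]; first by rewrite -[x]/(val (SeqSub xX)) -!gpermE st.
by apply/permP => x; apply: val_inj; rewrite !gpermE st ?(valP x).
Qed.

Definition fin_gal : {set {perm seq_sub X}} := [set p | `[< exists s, gperm s = p >]].

Lemma fin_galP p : reflect (exists s, gperm s = p) (p \in fin_gal).
Proof. by rewrite finset.inE; apply: asboolP. Qed.

Lemma gperm_in s : gperm s \in fin_gal.
Proof. by apply/fin_galP; exists s. Qed.

(** Permutations are multiplied from left to right, hence the reversed order. *)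
Lemma gperm_comp s t (r : galois iota) :
  (forall x : L, r x = s (t x)) -> gperm r = (gperm t * gperm s)%g.
Proof. by move=> rE; apply/permP => x; apply: val_inj; rewrite permM !gpermE rE. Qed.

Lemma gperm_id s : (forall x : L, s x = x) -> gperm s = 1%g.
Proof. by move=> sE; apply/permP => x; apply: val_inj; rewrite perm1 gpermE sE. Qed.

Lemma fin_gal_group_set : group_set fin_gal.
Proof.
apply/group_setP; split.
  by have [s sE] := gal_id_exists iota; rewrite -(gperm_id sE) gperm_in.
move=> p q /fin_galP[t <-] /fin_galP[s <-]; have [r rE] := gal_comp_exists s t.
by rewrite -(gperm_comp rE) gperm_in.
Qed.

Canonical fin_gal_group := Group fin_gal_group_set.

Lemma lift_exists p : exists s, p \in fin_gal -> gperm s = p.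
Proof.
have [s0 _] := gal_id_exists iota.
by case: (fin_galP p) => [[s <-]|_]; [exists s|exists s0].
Qed.

(* A choice of preimage; meaningless outside [fin_gal]. *)
Definition lift p : galois iota := projT1 (cid (lift_exists p)).

Lemma liftP p : p \in fin_gal -> gperm (lift p) = p.
Proof. exact: projT2 (cid (lift_exists p)). Qed.

(* The field generated by [X] over [K], seen as the elements on which a Galois
   automorphism is determined by its restriction to [X]. *)
Definition finF : {pred L} :=
  [pred x | `[< forall s t, {in X, s =1 t} -> s x = t x >]].

Lemma finFP x : reflect (forall s t, {in X, s =1 t} -> s x = t x) (x \in finF).
Proof. by rewrite unfold_in; apply: asboolP. Qed.

Lemma finF_divring : divring_closed finF.
Proof.
split.
- by apply/finFP => s t _; rewrite !rmorph1.
- by move=> x y /finFP xF /finFP yF; apply/finFP => s t st; rewrite !rmorphB (xF s t) ?(yF s t).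
- by move=> x y /finFP xF /finFP yF; apply/finFP => s t st; rewrite !fmorph_div (xF s t) ?(yF s t).
Qed.

HB.instance Definition _ := GRing.isDivringClosed.Build L finF finF_divring.

Lemma finFM x y : x \in finF -> y \in finF -> x * y \in finF. Proof. exact: rpredM. Qed.
Lemma finFX n x : x \in finF -> x ^+ n \in finF. Proof. exact: rpredX. Qed.

Lemma finF_mem x : x \in X -> x \in finF.
Proof. by move=> xX; apply/finFP => s t; apply. Qed.

Lemma finF_iota a : iota a \in finF.
Proof. by apply/finFP => s t _; rewrite !gal_fix. Qed.

Lemma finF_gal s x : x \in finF -> s x \in finF.
Proof.
move=> /finFP xF; apply/finFP => t1 t2 t12.
have [r1 r1E] := gal_comp_exists t1 s; have [r2 r2E] := gal_comp_exists t2 s.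
by rewrite -r1E -r2E; apply: xF => y yX; rewrite r1E r2E t12 // stabX.
Qed.

Lemma lift_gperm s x : x \in finF -> lift (gperm s) x = s x.
Proof. by move=> /finFP; apply; apply/gperm_eqP; rewrite liftP ?gperm_in. Qed.

Lemma lift_mul p q x : p \in fin_gal -> q \in fin_gal -> x \in finF ->
  lift (p * q)%g x = lift q (lift p x).
Proof.
move=> pG qG xF; have [r rE] := gal_comp_exists (lift q) (lift p).
by rewrite -(liftP pG) -(liftP qG) -(gperm_comp rE) lift_gperm // rE !liftP.
Qed.

Lemma lift1 x : x \in finF -> lift 1%g x = x.
Proof.
move=> xF; have [s sE] := gal_id_exists iota.
by rewrite -(gperm_id sE) lift_gperm.
Qed.

Hypotheses (charK : [pchar K] =i pred0) (algL : forall x : L, algebraicOver iota x).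

Lemma trace_in_base x : x \in finF -> exists a, \sum_(p in fin_gal) lift p x = iota a.
Proof.
move=> xF; apply: (galois_fixed algL charK) => s.
rewrite rmorph_sum [RHS](reindex_inj (mulIg (gperm s))) /=.
apply: eq_big => [p|p pG]; first by rewrite groupMr ?gperm_in.
by rewrite lift_mul ?gperm_in // lift_gperm ?finF_gal.
Qed.

Context (v : discrete_valuation K) (A : valring L).
Hypothesis AK : forall a, (iota a \in A) = (a \in vring v).

(** The decomposition group of [A] in the finite group acting on [finF]. One inclusion is enough,
    since inverses in a finite group are powers. *)
Definition decomp : {set {perm seq_sub X}} :=
  [set p in fin_gal | `[< forall x, x \in finF -> x \in A -> lift p x \in A >]].

Lemma decompP p : reflect (p \in fin_gal /\ forall x, x \in finF -> x \in A -> lift p x \in A)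
  (p \in decomp).
Proof. by rewrite [_ \in decomp]finset.in_set; apply: (iffP andP) => -[h] /asboolP. Qed.

Lemma decomp_group_set : group_set decomp.
Proof.
apply/group_setP; split.
  by apply/decompP; split=> [|x xF xA]; rewrite ?group1 // lift1.
move=> p q /decompP[pG pA] /decompP[qG qA]; apply/decompP; split; first by rewrite groupM.
by move=> x xF xA; rewrite lift_mul // qA ?finF_gal ?pA.
Qed.

Canonical decomp_group := Group decomp_group_set.

Lemma decomp_gal p : p \in decomp -> p \in fin_gal. Proof. by case/decompP. Qed.

Lemma decomp_vunits p x : p \in decomp -> x \in finF -> x \in vunits A ->
  lift p x \in vunits A.
Proof.
move=> /decompP[pG pA] xF /vunitsP[x0 xA xVA].
by rewrite inE fmorph_eq0 x0 pA //= -fmorphV pA // rpredV.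
Qed.

(** Some power of [x] is a unit times a constant from [K], and [p] fixes that constant. *)
Lemma decomp_ratio p x : p \in decomp -> x \in finF -> x != 0 ->
  lift p x / x \in vunits A.
Proof.
move=> pD xF x0; have [n [c [n0 c0 xc]]] := power_approx A algL x0.
apply: (vunitsXn_inv n0).
have cF : iota c \in finF by apply: finF_iota.
have uF : x ^+ n / iota c \in finF by rewrite rpred_div ?rpredX.
have := decomp_vunits pD uF xc; rewrite fmorph_div rmorphXn /= gal_fix => h.
have ic0 : iota c != 0 by rewrite fmorph_eq0.
have -> : (lift p x / x) ^+ n = (lift p x ^+ n / iota c) / (x ^+ n / iota c).
  by rewrite exprMn exprVn; field; rewrite ic0 expf_neq0.
exact: rpred_div h xc.
Qed.

(** Some integral [a] has a non-integral image under [p]. If [a ^+ n] is a unit times [c], then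
    [c / a ^+ n] is a unit, and its image is the integral [c] over a power of that non-integral
    element. *)
Lemma separating_one p : p \in fin_gal -> p \notin decomp -> exists a,
  [/\ a \in finF, a \in vunits A & lift p a \in vmax A].
Proof.
move=> pG pD.
have [a [aF aA paA]] : exists a, [/\ a \in finF, a \in A & lift p a \notin A].
  apply: contrapT => no; case/negP: pD; apply/decompP; split=> // x xF xA.
  by apply/negPn/negP => pxA; apply: no; exists x.
have a0 : a != 0 by apply: contraNneq paA => ->; rewrite rmorph0 rpred0.
have [n [c [n0 c0 ac]]] := power_approx A algL a0.
have ic0 : iota c != 0 by rewrite fmorph_eq0.
have cA : iota c \in A.
  have -> : iota c = a ^+ n * (a ^+ n / iota c)^-1.
    by rewrite invf_div mulrCA mulfV ?mulr1 // expf_neq0.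
  by apply: rpredM (rpredX n aA) _; apply: vunits_vr; rewrite rpredV.
exists (iota c / a ^+ n); split.
- by rewrite rpred_div ?finF_iota ?rpredX.
- by rewrite -invf_div rpredV.
- rewrite fmorph_div rmorphXn /= gal_fix vmaxMr // -exprVn.
  case: n n0 {ac} => // n _; rewrite exprS vmaxMl ?notin_vrV //.
  by rewrite rpredX // vmax_vr // notin_vrV.
Qed.

(* The rational function [a / (1 + w a ^ k)] makes every conjugate integral,
   without changing the values of those that were so already. *)
Lemma separating_one_integral p : p \in fin_gal -> p \notin decomp -> exists z,
  [/\ z \in finF, z \in vunits A, lift p z \in vmax A & forall q, lift q z \in A].
Proof.
move=> pG pD; have [a [aF aU pam]] := separating_one pG pD.
have [w w0 vw] := dval_pos_exists v; set W := iota w.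
have Wm : W \in vmax A by rewrite (vmax_iota AK) vw orbT.
have W0 : W != 0 by rewrite fmorph_eq0.
have [k kP] : exists k, forall q k', (k <= k')%N -> lift q a \notin A ->
    (lift q a)^-1 ^+ k' * W^-1 \in vmax A.
  apply: uniform_bound => q; have [qA|qA] := boolP (lift q a \in A); first by exists 0.
  have [M MP] := vmax_power AK algL W^-1 (notin_vrV qA).
  by exists M => k Mk _; apply: MP.
have unit1 x : x \in A -> 1 + W * x ^+ k.+1 \in vunits A.
  by move=> xA; rewrite vunitsDm ?rpred1 // vmaxMl ?rpredX.
pose z := a / (1 + W * a ^+ k.+1).
have qz q : lift q z = lift q a / (1 + W * lift q a ^+ k.+1).
  by rewrite fmorph_div rmorphD rmorphM rmorphXn rmorph1 /= gal_fix.
exists z; split.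
- have h1 : a ^+ k.+1 \in finF by rewrite rpredX.
  have h2 : W * a ^+ k.+1 \in finF by rewrite rpredM ?finF_iota.
  have h3 : 1 + W * a ^+ k.+1 \in finF by rewrite rpredD ?rpred1.
  by rewrite /z rpred_div.
- exact: rpred_div aU (unit1 _ (vunits_vr aU)).
- have pA := vmax_vr pam.
  by rewrite qz vmaxMl // vunits_vr // rpredV unit1.
- move=> q; rewrite qz; set x := lift q a.
  have [xA|xA] := boolP (x \in A); first by rewrite rpredM // vunits_vr // rpredV unit1.
  have x0 : x != 0 by apply: contraNneq xA => ->; rewrite rpred0.
  (* Otherwise the inverse is integral, and so is [W * x ^+ k], although the choice of [k] put the
     inverse of the latter in the maximal ideal. *)
  have [//|h] := vr_total A (x / (1 + W * x ^+ k.+1)).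
  have := kP q k (leqnn k) xA; rewrite -/x inE mulf_eq0 expf_eq0 !invr_eq0 (negPf x0) (negPf W0).
  rewrite andbF /= => /negP[]; rewrite invf_div in h.
  have -> : (x^-1 ^+ k / W)^-1 = (1 + W * x ^+ k.+1) / x - x^-1.
    have := expf_neq0 k x0; rewrite exprVn exprS; move: (x ^+ k) => y y0.
    by field; apply/and4P; split=> //; apply: oner_neq0.
  by rewrite rpredB // vmax_vr // notin_vrV.
Qed.

(** The product of the elements from [separating_one_integral], one for each [p] outside [decomp],
    is sent into the maximal ideal by every such [p], because the other factors have integral
    conjugates. A norm over [decomp] then makes it invariant. *)
Lemma separating_element : exists u, [/\ u \in finF, u \in vunits A,
  forall p, p \in decomp -> lift p u = u &
  forall p, p \in fin_gal -> p \notin decomp -> lift p u \in vmax A].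
Proof.
have /choice[z zP] : forall p, exists z, p \in fin_gal :\: decomp ->
    [/\ z \in finF, z \in vunits A, lift p z \in vmax A & forall q, lift q z \in A].
  move=> p; have [|_] := boolP (p \in _ :\: _); last by exists 0.
  by rewrite finset.in_setD => /andP[pD pG]; have [z zP] := separating_one_integral pG pD; exists z.
pose u0 := \prod_(p in fin_gal :\: decomp) z p.
have u0F : u0 \in finF by rewrite rpred_prod // => p /zP[].
have u0U : u0 \in vunits A by rewrite rpred_prod // => p /zP[].
have u0m p : p \in fin_gal -> p \notin decomp -> lift p u0 \in vmax A.
  move=> pG pD; have pGD : p \in fin_gal :\: decomp by rewrite finset.in_setD pD.
  rewrite rmorph_prod (bigD1 p) //= vmaxMl //; first by have [] := zP p pGD.
  by rewrite rpred_prod // => q /andP[/zP[_ _ _ h] _]; apply: h.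
pose u := \prod_(q in decomp) lift q u0.
have uE p : p \in fin_gal -> lift p u = \prod_(q in decomp) lift (q * p)%g u0.
  move=> pG; rewrite rmorph_prod; apply: eq_bigr => q qD.
  by rewrite lift_mul // decomp_gal.
exists u; split.
- by rewrite rpred_prod // => q qD; apply: finF_gal.
- by rewrite rpred_prod // => q qD; apply: decomp_vunits.
- move=> p pD; rewrite uE ?decomp_gal // [RHS](reindex_inj (mulIg p)) /=.
  by apply: eq_bigl => q; rewrite groupMr.
- move=> p pG pD; rewrite uE // (bigD1 1%g) ?group1 //= vmaxMl //.
    by rewrite mul1g u0m.
  rewrite rpred_prod // => q /andP[qD _]; apply: vmax_vr; apply: u0m.
    by rewrite groupM // decomp_gal.
  by rewrite groupMl.
Qed.

Definition decomp_stab (z : L) : {set {perm seq_sub X}} := [set p in decomp | lift p z == z].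

Lemma decomp_stab_group_set z : z \in finF -> group_set (decomp_stab z).
Proof.
move=> zF; apply/group_setP; split; first by rewrite finset.in_set group1 lift1 ?eqxx.
move=> p q; rewrite ![_ \in decomp_stab _]finset.in_set => /andP[pD /eqP pz] /andP[qD /eqP qz].
by rewrite groupM // lift_mul ?decomp_gal // pz qz eqxx.
Qed.

(* The averages are [T_i = sum_p p (y z^i u^M)], with [y] the norm of [b] and [u]
   a separating element.  As [sum_i z^(N-1-i) p(z)^i] vanishes unless [p] fixes
   [z], the combination [sum_i z^(N-1-i) T_i] is a unit times [y], so one of the
   [T_i] is already a unit times [y]. *)
Theorem decomp_stab_ramification (b z : L) (N : nat) :
  b \in finF -> b != 0 -> z \in finF -> z ^+ N = 1 -> (0 < N)%N ->
  N%:R \in vunits A -> #|decomp_stab z|%:R \in vunits A ->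
  exists2 c, c != 0 & iota c / b ^+ #|decomp_stab z| \in vunits A.
Proof.
move=> bF b0 zF zN N0 NU JU; set J := decomp_stab z in JU *.
pose JG := Group (decomp_stab_group_set zF).
have JD p : p \in J -> p \in decomp by rewrite [_ \in J]finset.in_set => /andP[].
have Jz p : p \in J -> lift p z = z by rewrite [_ \in J]finset.in_set => /andP[_ /eqP].
have zU : z \in vunits A by apply: (vunitsXn_inv N0); rewrite zN rpred1.
have z0 := vunits_neq0 zU.
have [u [uF uU uD um]] := separating_element.
pose y := \prod_(p in J) lift p b.
have yF : y \in finF by rewrite rpred_prod // => p pJ; apply: finF_gal.
have y0 : y != 0.
  by rewrite /y prodf_seq_neq0; apply/allP => p _; rewrite fmorph_eq0 b0 implybT.
have yJ p : p \in J -> lift p y = y.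
  move=> pJ; have pG := decomp_gal (JD p pJ).
  rewrite rmorph_prod [RHS](reindex_inj (mulIg p)) /=.
  apply: eq_big => [q|q qJ]; first by rewrite -[J]/(gval JG) groupMr.
  by rewrite lift_mul // decomp_gal // JD.
(* Outside [decomp] nothing bounds the ratio [lift p y / y]; a high power of [lift p u] outweighs
   it. *)
have [M MP] : exists M, forall p k, (M <= k)%N -> p \in fin_gal -> p \notin decomp ->
    lift p u ^+ k * (lift p y / y) \in vmax A.
  apply: uniform_bound => p.
  have [/andP[pG pD]|no] := boolP ((p \in fin_gal) && (p \notin decomp)).
    have [M MP] := vmax_power AK algL (lift p y / y) (um p pG pD).
    by exists M => k Mk _ _; apply: MP.
  by exists 0 => k _ pG pD; rewrite pG pD in no.
pose x i := y * z ^+ i * u ^+ M.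
have xF i : x i \in finF by rewrite !finFM ?finFX.
have xE p i : lift p (x i) = lift p (y * u ^+ M) * lift p z ^+ i.
  by rewrite /x mulrAC [LHS]rmorphM [in LHS]rmorphXn.
have pzN p : lift p z ^+ N = 1 by rewrite -rmorphXn zN rmorph1.
have pzA p : lift p z \in A by apply: (vrXn_inv N0); rewrite pzN rpred1.
have pyA p : p \in fin_gal -> lift p (y * u ^+ M) / y \in A.
  move=> pG; rewrite rmorphM rmorphXn /= [_ * _ ^+ M]mulrC -mulrA.
  have [pD|pD] := boolP (p \in decomp); last by rewrite vmax_vr ?MP.
  by rewrite uD // vrM ?vrX ?(vunits_vr uU) // vunits_vr ?decomp_ratio.
have /choice[t tE] := fun i => trace_in_base (xF i).
have tA i : iota (t i) / y \in A.
  rewrite -tE mulr_suml rpred_sum // => p pG.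
  by rewrite xE mulrAC vrM ?vrX // pyA.
have zsum p : \sum_(i < N) z ^+ (N.-1 - i) * lift p z ^+ i =
    if lift p z == z then N%:R * z ^+ N.-1 else 0.
  have [->|pz] := eqVneq (lift p z) z.
    rewrite mulr_natl -[X in _ *+ X]card_ord -sumr_const; apply: eq_bigr => i _.
    by rewrite -exprD subnK // -ltnS prednK.
  have := subrXX z (lift p z) N; rewrite zN pzN subrr => /esym/eqP.
  by rewrite mulf_eq0 subr_eq0 eq_sym (negPf pz) /= => /eqP.
have sumE : \sum_(i < N) z ^+ (N.-1 - i) * (iota (t i) / y) =
    N%:R * z ^+ N.-1 * (\sum_(p in fin_gal | lift p z == z) lift p (y * u ^+ M) / y).
  transitivity (\sum_(p in fin_gal) (lift p (y * u ^+ M) / y) *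
      \sum_(i < N) z ^+ (N.-1 - i) * lift p z ^+ i).
    under eq_bigr => i _ do rewrite -tE mulr_suml mulr_sumr.
    rewrite exchange_big /=; apply: eq_bigr => p pG; rewrite mulr_sumr.
    by apply: eq_bigr => i _; rewrite xE; ring.
  rewrite mulr_sumr big_mkcondr /=; apply: eq_bigr => p pG.
  by rewrite zsum; case: ifP => _; rewrite ?mulr0 // mulrC.
have sumU : \sum_(i < N) z ^+ (N.-1 - i) * (iota (t i) / y) \in vunits A.
  (* Each element of [J] contributes [u ^+ M], and their number is a unit by hypothesis; the terms
     outside [decomp] are in the maximal ideal. *)
  rewrite sumE vunitsM ?vunitsM ?vunitsX // (bigID (mem decomp)) /= vunitsDm //.
    rewrite (eq_bigl (mem J)) => [|p]; last first.
      rewrite /= [_ \in J]finset.in_set andbC; case: (boolP (p \in decomp)) => //= pD.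
      by rewrite decomp_gal.
    rewrite (eq_bigr (fun=> u ^+ M)) => [|p pJ].
      by rewrite sumr_const -mulr_natl vunitsM ?vunitsX.
    by rewrite rmorphM rmorphXn /= yJ // uD ?JD // mulrAC mulfV ?mul1r.
  rewrite rpred_sum // => p /andP[/andP[pG _] pD].
  by rewrite rmorphM rmorphXn /= [_ * _ ^+ M]mulrC -mulrA MP.
have [i iU] : exists i, iota (t i) / y \in vunits A.
  apply: contrapT => no; move: sumU; rewrite vunitsE => /andP[_ /negP[]].
  rewrite rpred_sum // => i _; rewrite vmaxMr ?vrX ?(vunits_vr zU) //.
  by apply/negPn/negP => im; apply: no; exists i; rewrite vunitsE tA im.
exists (t i); first by apply: contraTneq iU => ->; rewrite rmorph0 mul0r inE eqxx.
(* Elements of [decomp] preserve sizes, so the norm [y] has the size of [b ^+ #|J|]. *)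
have yb : y / b ^+ #|J| \in vunits A.
  rewrite -prodr_const -prodf_div rpred_prod // => p pJ.
  by rewrite decomp_ratio ?JD.
have -> : iota (t i) / b ^+ #|J| = iota (t i) / y * (y / b ^+ #|J|) by rewrite mulrA divfK.
exact: vunitsM.
Qed.

End FiniteLevel.

(** * Classes modulo principal units *)

Section Equivalence.
Context (L : fieldType) (A : valring L).
Implicit Types x y z t : L.

(* Equality of classes in [L^*] modulo [1 + m]; false when [x] or [y] is zero. *)
Definition veq x y := x / y \in vunits1 A.

Lemma veqE x y : veq x y = (x / y - 1 \in vmax A). Proof. by []. Qed.

Lemma veq_neq0 x y : veq x y -> x != 0 /\ y != 0.
Proof. by move=> /vunits1P/vunits_neq0; rewrite mulf_eq0 negb_or invr_eq0 => /andP. Qed.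

Lemma veq_refl x : x != 0 -> veq x x.
Proof. by move=> x0; rewrite /veq mulfV // rpred1. Qed.

Lemma veq_sym x y : veq x y -> veq y x.
Proof. by rewrite /veq => xy; rewrite -invf_div rpredV. Qed.

Lemma veq_trans x y z : veq x y -> veq y z -> veq x z.
Proof.
move=> xy yz; have [_ y0] := veq_neq0 xy.
rewrite /veq; have -> : x / z = x / y * (y / z) by rewrite mulrA divfK.
exact: rpredM.
Qed.

Lemma veqM x y z t : veq x y -> veq z t -> veq (x * z) (y * t).
Proof. by move=> xy zt; rewrite /veq invfM mulrACA rpredM. Qed.

Lemma veqX n x y : veq x y -> veq (x ^+ n) (y ^+ n).
Proof. by move=> xy; rewrite /veq -exprVn -exprMn rpredX. Qed.

Lemma veq_cancel w x y : veq (x * w) (y * w) -> veq x y.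
Proof.
move=> h; have [_] := veq_neq0 h; rewrite mulf_eq0 negb_or => /andP[_ w0].
by move: h; rewrite /veq invfM mulrACA mulfV // mulr1.
Qed.

Lemma veq_unity n x y : n%:R \in vunits A -> x ^+ n = 1 -> y ^+ n = 1 -> veq x y -> x = y.
Proof.
move=> nU xn yn xy; have [_ y0] := veq_neq0 xy; apply: (mulIf (invr_neq0 y0)).
by rewrite mulfV //; apply: (unity_vunits1 nU) xy; rewrite exprMn exprVn xn yn divr1.
Qed.

End Equivalence.

(** * Polynomials with unit leading coefficient at non-integral arguments *)

Section LargeArguments.
Context (L : fieldType) (A : valring L) (p : {poly L}).
Hypotheses (pA : p \is a polyOver A) (lcU : lead_coef p \in vunits A).
Local Notation n := (size p).-1.

Let p_size : size p = n.+1.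
Proof.
by rewrite prednK // size_poly_gt0 -lead_coef_eq0 (vunits_neq0 lcU).
Qed.

(** Relative to the leading term, a term of lower index [i] carries the positive power
    [x^-1 ^+ (n - i)]. The weights serve twice: the constant 1 gives the value of [p], geometric
    sums give its difference quotient. *)
Lemma horner_large_weighted (c : nat -> L) x : (forall i, c i \in A) -> x \notin A ->
  (\sum_(i < size p) p`_i * x ^+ i * c i) / (lead_coef p * x ^+ n) - c n \in vmax A.
Proof.
move=> cA xA; have xm := notin_vrV xA.
have x0 : x != 0 by apply: contraNneq xA => ->; rewrite rpred0.
have l0 := vunits_neq0 lcU; have lVA : (lead_coef p)^-1 \in A by case/vunitsP: lcU.
rewrite p_size big_ord_recr /= -lead_coefE mulrDl mulrAC mulfV ?mul1r ?mulf_neq0 ?expf_neq0 //.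
rewrite addrK mulr_suml rpred_sum // => i _.
have -> : p`_i * x ^+ i * c i / (lead_coef p * x ^+ n) =
    x^-1 ^+ (n - i) * (p`_i * c i / lead_coef p).
  have -> : x ^+ n = x ^+ (n - i) * x ^+ i by rewrite -exprD subnK // ltnW.
  have := expf_neq0 i x0; have := expf_neq0 (n - i) x0.
  rewrite exprVn; move: (x ^+ i) (x ^+ (n - i)) => y z z0 y0.
  by field; rewrite l0 y0 z0.
rewrite vmaxMl //; last by rewrite vrM // vrM // (polyOverP pA).
have : (0 < n - i)%N by rewrite subn_gt0.
by case: (n - i)%N => // k _; rewrite exprS vmaxMl // vrX // vmax_vr.
Qed.

Lemma horner_large x : x \notin A -> veq A p.[x] (lead_coef p * x ^+ n).
Proof.
move=> xA; rewrite veqE horner_coef.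
have := @horner_large_weighted (fun=> 1) x (fun=> rpred1 _) xA.
by under eq_bigr do rewrite mulr1.
Qed.

(** With [y = r * x], the difference [p.[y] - p.[x]] is [(r - 1) * S], where [S] weights the terms
    of [p.[x]] by geometric sums in [r]. The top weight is congruent to [n], hence a unit, so [S] is
    nonzero. *)
Lemma horner_large_inj x y : n%:R \in vunits A -> x \notin A -> veq A y x ->
  p.[x] = p.[y] -> x = y.
Proof.
move=> nU xA yx pxy; set r := y / x in yx.
have x0 : x != 0 by apply: contraNneq xA => ->; rewrite rpred0.
have yE : y = r * x by rewrite divfK.
have rA := vunits_vr (vunits1P yx).
pose c i := \sum_(j < i) r ^+ j.
have cA i : c i \in A by rewrite rpred_sum // => j _; rewrite vrX.
have cU : c n \in vunits A.
  by rewrite -[c n](addrNK n%:R) addrC vunitsDm // geo_sum_vunits1.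
have := horner_large_weighted cA xA; set S := \sum_(i < _) _ => Sm.
have : S / (lead_coef p * x ^+ n) != 0.
  by apply: (@vunits_neq0 _ A); rewrite -[_ / _](addrNK (c n)) addrC vunitsDm.
rewrite mulf_eq0 negb_or => /andP[S0 _].
have : (r - 1) * S = 0.
  transitivity (p.[y] - p.[x]); last by rewrite pxy subrr.
  rewrite !horner_coef -sumrB mulr_sumr; apply: eq_bigr => i _.
  by rewrite yE exprMn mulrCA -subrX1; ring.
by move/eqP; rewrite mulf_eq0 (negPf S0) orbF subr_eq0 yE => /eqP->; rewrite mul1r.
Qed.

End LargeArguments.

(** The product of [1 - r / z] over the roots [r] of [p - c%:P] is [p.[z] - c] divided by the
    leading term at [z]. It lies in the maximal ideal, hence so does a factor. With [L]
    algebraically closed, this takes the place of Hensel's lemma. *)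
Lemma horner_large_root (L : closedFieldType) (A : valring L) (p : {poly L}) z c :
  p \is a polyOver A -> lead_coef p \in vunits A -> (1 < size p)%N -> z \notin A ->
  veq A c (lead_coef p * z ^+ (size p).-1) ->
  exists x, p.[x] = c /\ veq A x z.
Proof.
move=> pA lcU sp zA cz.
have z0 : z != 0 by apply: contraNneq zA => ->; rewrite rpred0.
have l0 := vunits_neq0 lcU.
pose q := p - c%:P.
have sc : (size (- c%:P) < size p)%N.
  by rewrite size_polyN size_polyC (leq_trans _ sp) // ltnS leq_b1.
have sq : size q = size p by rewrite size_polyDl.
have lq : lead_coef q = lead_coef p by rewrite lead_coefDl.
have [rs qE] := closed_field_poly_normal q; rewrite lq in qE.
have srs : size rs = (size p).-1.
  by have := sq; rewrite qE size_scale // size_prod_XsubC => <-.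
have : \prod_(r <- rs) (1 - r / z) \in vmax A.
  have -> : \prod_(r <- rs) (1 - r / z) = q.[z] / (lead_coef p * z ^+ (size p).-1).
    rewrite (eq_bigr (fun r => (z - r) * z^-1)) => [|r _]; last by rewrite mulrBl mulfV.
    rewrite big_split /= big_const_seq count_predT iter_mulr_1 srs exprVn.
    rewrite qE hornerZ horner_prod invfM mulrACA mulfV // mul1r.
    by congr (_ * _); apply: eq_bigr => r _; rewrite hornerXsubC.
  have := horner_large pA lcU zA; rewrite !veqE in cz *.
  rewrite hornerD hornerN hornerC mulrBl => pz.
  by have := rpredB pz cz; rewrite opprB addrA subrK.
case/vmax_prod => r rrs rm; exists r; split.
  apply/eqP; rewrite -subr_eq0 -[c](hornerC _ r) -hornerN -hornerD -/q.
  by rewrite -[_ == 0]/(root q r) qE rootZ // root_prod_XsubC.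
by rewrite veqE -opprB rpredN.
Qed.

(** * Compatible systems of primitive roots of unity *)

Section RootsOfUnity.
Context (L : closedFieldType).

Lemma prim_root_exists n : (n%:R : L) != 0 -> exists z : L, n.-primitive_root z.
Proof.
move=> n0; have [rs rsE] := closed_field_poly_normal ('X^n - 1 : {poly L}).
have npos : (0 < n)%N by apply: contraNT n0; rewrite -eqn0Ngt => /eqP->.
have lc1 : lead_coef ('X^n - 1 : {poly L}) = 1 by apply/monicP/monicXnsubC.
rewrite lc1 scale1r in rsE.
have /hasP[z _ zn] : has n.-primitive_root rs.
  apply: has_prim_root => //.
  - by apply/allP => x xs; rewrite /root_of_unity rsE root_prod_XsubC.
  - by rewrite -separable_prod_XsubC -rsE separable_Xn_sub_1.
  - by have := size_prod_XsubC rs id; rewrite -rsE size_XnsubC // => -[<-].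
by exists z.
Qed.

(* The twist by [e] matches the relation [x ^ d ~ y ^ e] between a vertex [y]
   and the vertices [x] above it. *)
Lemma twisted_prim_roots (d e : nat) : (forall n, ((d ^ n)%:R : L) != 0) -> coprime e d ->
  exists z : nat -> L, forall n, (d ^ n)%N.-primitive_root (z n) /\ z n.+1 ^+ d = z n ^+ e.
Proof.
move=> dN0 ed.
have d0 : (0 < d)%N by have := dN0 1%N; rewrite expn1; case: d {dN0 ed} => //; rewrite eqxx.
have step (nz : nat * L) : exists w, (d ^ nz.1)%N.-primitive_root nz.2 ->
    (d ^ nz.1.+1)%N.-primitive_root w /\ w ^+ d = nz.2 ^+ e.
  case: nz => n z /=; have [u un] := prim_root_exists (dN0 n.+1).
  have [zn|zn] := boolP ((d ^ n)%N.-primitive_root z); last by exists 0.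
  have ud : (d ^ n)%N.-primitive_root (u ^+ d).
    by have := dvdn_prim_root un (dvdn_exp2l d (leqnSn n)); rewrite expnS mulnK ?expn_gt0 ?d0.
  (* Level 0 is separate: coprimality of [k] to [d ^ n] gives coprimality to [d] only when the
     exponent is positive. *)
  case: n zn ud un => [|n] zn ud un.
    exists u => _; split=> //; move: (prim_expr_order ud) (prim_expr_order zn).
    by rewrite expn0 !expr1 => -> ->; rewrite expr1n.
  have ze : (d ^ n.+1)%N.-primitive_root (z ^+ e).
    by rewrite prim_root_exp_coprime // coprimeXr.
  have [k kE] := prim_rootP ud (prim_expr_order ze).
  exists (u ^+ k) => _; split; last by rewrite kE exprAC.
  rewrite prim_root_exp_coprime //; move: ze; rewrite kE prim_root_exp_coprime //.
  by rewrite !coprime_pexpr.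
have /choice[w wP] := step.
pose z := fix z n := if n is m.+1 then w (m, z m) else 1.
have zprim n : (d ^ n)%N.-primitive_root (z n).
  elim: n => [|n IH]; last by have [] := wP (n, z n) IH.
  by apply/andP; split=> //; apply/forallP => i; rewrite ord1 unity_rootE expr1n !eqxx.
by exists z => n; split=> //; have [] := wP (n, z n) (zprim n).
Qed.

End RootsOfUnity.

(** * Labelling the backward tree *)

Section Tree.
Context (L : closedFieldType) (A : valring L) (F G : {poly L}) (alpha : L).
Local Notation d := (size F).-1.
Local Notation e := (size G).-1.
Hypotheses (FA : F \is a polyOver A) (GA : G \is a polyOver A).
Hypotheses (FU : lead_coef F \in vunits A) (GU : lead_coef G \in vunits A).
Hypotheses (e0 : (0 < e)%N) (ed : (e < d)%N) (dU : d%:R \in vunits A) (cop : coprime e d).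
Hypothesis alphaA : alpha \notin A.

Fixpoint lev n x : Prop :=
  if n is m.+1 then exists2 y, lev m y & F.[x] = G.[y] else x = alpha.

Let d0 : (0 < d)%N. Proof. exact: leq_ltn_trans ed. Qed.

Let dnU n : (d ^ n)%:R \in vunits A. Proof. by rewrite natrX vunitsX. Qed.

(** For non-integral [y], [G.[y]] has the size of [y ^+ e], whereas [F.[x]] is integral if [x] is.
    Hence backward paths from [alpha] never meet [A]. *)
Lemma edge_notin x y : F.[x] = G.[y] -> y \notin A -> x \notin A.
Proof.
move=> xy yA; apply: contra yA => xA; apply: (vrXn_inv e0).
have GyA : G.[y] \in A.
  rewrite -xy horner_coef rpred_sum // => i _.
  by rewrite vrM ?vrX // (polyOverP FA).
have [yA|{}yA] := boolP (y \in A); first by rewrite vrX.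
have h := horner_large GA GU yA; have [_ g0] := veq_neq0 h.
have [l0 lA lVA] := vunitsP GU.
have -> : y ^+ e = (lead_coef G)^-1 * ((G.[y] / (lead_coef G * y ^+ e))^-1 * G.[y]).
  have [Gy0 _] := veq_neq0 h.
  by rewrite invf_div divfK // mulKf.
by rewrite vrM // vrM // vunits_vr // rpredV; apply: vunits1P.
Qed.

Lemma lev_notin n x : lev n x -> x \notin A.
Proof. by elim: n x => [x ->|n IH x [y /IH yA /edge_notin]] //; apply. Qed.

Lemma notin_neq0 x : x \notin A -> x != 0.
Proof. by apply: contraNneq => ->; rewrite rpred0. Qed.

Lemma edge_veq x y : F.[x] = G.[y] -> y \notin A ->
  veq A (lead_coef F * x ^+ d) (lead_coef G * y ^+ e).
Proof.
move=> xy yA; apply: veq_trans (horner_large GA GU yA); rewrite -xy.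
exact: veq_sym (horner_large FA FU (edge_notin xy yA)).
Qed.

(** In additive terms, the value at level [n] is [(e / d) ^ n] times that of [alpha]: the leading
    coefficients being units, each edge multiplies the value by [e / d]. *)
Lemma lev_power n x : lev n x -> x ^+ (d ^ n) / alpha ^+ (e ^ n) \in vunits A.
Proof.
elim: n x => [x ->|n IH x [y yn xy]].
  by rewrite !expr1 mulfV ?rpred1 ?notin_neq0.
have yA := lev_notin yn; have y0 := notin_neq0 yA.
have h : x ^+ d / y ^+ e \in vunits A.
  have [l0 _ _] := vunitsP FU; have [k0 _ _] := vunitsP GU.
  have := vunits1P (edge_veq xy yA).
  have -> : x ^+ d / y ^+ e = (lead_coef F)^-1 * (lead_coef F * x ^+ d / (lead_coef G * y ^+ e)) *
      lead_coef G by field; rewrite l0 k0 expf_neq0.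
  by move=> h; apply: vunitsM => //; apply: vunitsM => //; rewrite rpredV.
have a0 := notin_neq0 alphaA.
have -> : x ^+ (d ^ n.+1) / alpha ^+ (e ^ n.+1) =
    (x ^+ d / y ^+ e) ^+ (d ^ n) * (y ^+ (d ^ n) / alpha ^+ (e ^ n)) ^+ e.
  rewrite !exprMn !exprVn -!exprM -expnS -expnSr [(d ^ n * e)%N]mulnC.
  by rewrite mulrA divfK // expf_neq0.
by rewrite vunitsM ?vunitsX ?IH.
Qed.

Lemma alpha_power_inj i j : alpha ^+ i / alpha ^+ j \in vunits A -> i = j.
Proof.
have a0 := notin_neq0 alphaA.
wlog ij : i j / (i <= j)%N.
  move=> W; have [ij|/ltnW ji] := leqP i j; first exact: W.
  by rewrite -invf_div rpredV => /(W _ _ ji).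
rewrite -[X in _ / alpha ^+ X](subnK ij) exprD invfM mulrCA mulfV ?expf_neq0 // mulr1 rpredV => h.
have [ij0|ij0] := posnP (j - i)%N.
  by apply/eqP; rewrite eqn_leq ij -subn_eq0 ij0.
by have /vunits_vr := vunitsXn_inv ij0 h; rewrite (negPf alphaA).
Qed.

(** Comparing values gives [e ^ m * d ^ n = e ^ n * d ^ m], impossible for distinct levels since
    [e < d]. This is how polarization yields a tree. *)
Lemma lev_inj n m x : lev n x -> lev m x -> n = m.
Proof.
wlog nm : n m / (n <= m)%N.
  by move=> W xn xm; have [h|/ltnW h] := leqP n m; [apply: W|apply/esym/W].
move=> xn xm; have a0 := notin_neq0 alphaA; have x0 := notin_neq0 (lev_notin xn).
have h : alpha ^+ (e ^ m * d ^ n) / alpha ^+ (e ^ n * d ^ m) \in vunits A.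
  have -> : alpha ^+ (e ^ m * d ^ n) / alpha ^+ (e ^ n * d ^ m) =
      (x ^+ (d ^ n) / alpha ^+ (e ^ n)) ^+ (d ^ m) / (x ^+ (d ^ m) / alpha ^+ (e ^ m)) ^+ (d ^ n).
    rewrite !exprMn !exprVn -!exprM [(d ^ n * d ^ m)%N]mulnC.
    by field; rewrite !expf_neq0.
  by apply: rpred_div; apply: vunitsX; apply: lev_power.
move/alpha_power_inj: h; rewrite -(subnK nm) !expnD => /eqP; move: (m - n)%N => k.
rewrite -mulnA [X in _ == X]mulnCA eqn_pmul2r ?muln_gt0 ?expn_gt0 ?e0 ?d0 //.
case: k => // k; rewrite eqn_exp2r //.
by rewrite (ltn_eqF ed).
Qed.

Lemma horner_onto c : exists x, F.[x] = c.
Proof.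
have [|x xc] := @closed_root L (F - c%:P).
  rewrite size_polyDl; first by move: d0; case: (size F) => [|[]].
  rewrite size_polyN size_polyC (leq_ltn_trans (leq_b1 _)) //.
  by move: d0; case: (size F) => [|[]].
by exists x; apply/eqP; rewrite -subr_eq0; move: xc; rewrite /root hornerD hornerN hornerC.
Qed.

(** An arbitrary infinite backward path, which will carry the label zero at every level. *)
Lemma ray_exists : exists b : nat -> L, b 0%N = alpha /\ forall n, F.[b n.+1] = G.[b n].
Proof.
have /choice[h hP] := fun y => horner_onto G.[y].
by exists (fun n => iter n h alpha); split=> // n; rewrite iterS.
Qed.

Context (b z : nat -> L).
Hypotheses (b0 : b 0%N = alpha) (bS : forall n, F.[b n.+1] = G.[b n]).
Hypotheses (zP : forall n, (d ^ n)%N.-primitive_root (z n)).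
Hypothesis (zS : forall n, z n.+1 ^+ d = z n ^+ e).

Lemma ray_lev n : lev n (b n).
Proof. by elim: n => [|n IH] //; exists (b n). Qed.

(** The label matters only modulo [d ^ n]. The product [z n ^+ k * b n] need not be a vertex; it
    only fixes a class modulo principal units. *)
Definition labelled n k x := lev n x /\ veq A x (z n ^+ k * b n).

Lemma zU n : z n \in vunits A.
Proof.
apply: (vunitsXn_inv (prim_order_gt0 (zP n))).
by rewrite (prim_expr_order (zP n)) rpred1.
Qed.

Lemma labelled0 k x : labelled 0 k x <-> x = alpha.
Proof.
split=> [[]//|->]; split=> //; have := prim_expr_order (zP 0).
by rewrite expr1 => ->; rewrite expr1n mul1r b0 veq_refl // notin_neq0.
Qed.

Lemma veq_z n k l : veq A (z n ^+ k) (z n ^+ l) -> k = l %[mod d ^ n].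
Proof.
move=> h; apply/eqP; rewrite -(eq_prim_root_expr (zP n)); apply/eqP.
by apply: (veq_unity (dnU n)) h; rewrite exprAC (prim_expr_order (zP n)) expr1n.
Qed.

Lemma labelled_mod n k l x : k = l %[mod d ^ n] -> labelled n k x -> labelled n l x.
Proof.
by move=> /eqP; rewrite -(eq_prim_root_expr (zP n)) /labelled => /eqP ->.
Qed.

Lemma labelled_inj n k l x : labelled n k x -> labelled n l x -> k = l %[mod d ^ n].
Proof.
move=> [_ xk] [_ xl]; apply: veq_z; have := veq_trans (veq_sym xk) xl.
have [_] := veq_neq0 xk; rewrite mulf_eq0 negb_or => /andP[_ bn0].
by rewrite /veq invfM mulrACA mulfV // mulr1.
Qed.

(** Along an edge, [lead_coef F * x ^+ d] and [lead_coef G * y ^+ e] have the same class. Dividing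
    by the same relation on the ray leaves [z n ^+ e ^+ k] and [z n ^+ e ^+ l], which must be equal;
    and [z n ^+ e] is still primitive because [e] is prime to [d]. *)
Lemma labelled_edge n k l x y : labelled n.+1 k x -> labelled n l y -> F.[x] = G.[y] ->
  k = l %[mod d ^ n].
Proof.
move=> [xn xk] [yn yl] xy.
have zex : (d ^ n)%N.-primitive_root (z n ^+ e).
  by rewrite prim_root_exp_coprime // coprimeXr.
apply/eqP; rewrite -(eq_prim_root_expr zex); apply/eqP.
apply: (veq_unity (dnU n)).
- by rewrite exprAC (prim_expr_order zex) expr1n.
- by rewrite exprAC (prim_expr_order zex) expr1n.
have l0 := vunits_neq0 FU; have m0 := vunits_neq0 GU.
have bn0 := notin_neq0 (lev_notin (ray_lev n)).
have bn1 := notin_neq0 (lev_notin (ray_lev n.+1)).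
have h1 := edge_veq xy (lev_notin yn).
have h2 := edge_veq (bS n) (lev_notin (ray_lev n)).
have zE : z n.+1 ^+ k ^+ d = z n ^+ e ^+ k by rewrite exprAC zS.
apply: (@veq_cancel _ _ (lead_coef F * b n.+1 ^+ d)).
apply: (@veq_trans _ _ _ (lead_coef F * x ^+ d)).
  have := veqM (veq_refl A l0) (veq_sym (veqX d xk)).
  by rewrite exprMn zE mulrCA.
apply: veq_trans h1 _; apply: (@veq_trans _ _ _ (z n ^+ e ^+ l * (lead_coef G * b n ^+ e))).
  by have := veqM (veq_refl A m0) (veqX e yl); rewrite exprMn mulrCA exprAC.
by apply: veqM (veq_sym h2); rewrite veq_refl // !expf_neq0 // (vunits_neq0 (zU n)).
Qed.

(** If the vertex below [x] has label [k], the ratio [t] of [x] to [z n.+1 ^+ k * b n.+1] has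
    [t ^+ d] among the principal units, so [t] is a root of unity up to a principal unit. *)
Lemma lev_labelled n x : lev n x -> exists k, labelled n k x.
Proof.
elim: n x => [x ->|n IH x [y yn xy]]; first by exists 0%N; apply/labelled0.
have [k [_ yk]] := IH y yn; have yA := lev_notin yn.
have l0 := vunits_neq0 FU; have m0 := vunits_neq0 GU.
have bn1 := notin_neq0 (lev_notin (ray_lev n.+1)).
have h1 := edge_veq xy yA.
have h2 := edge_veq (bS n) (lev_notin (ray_lev n)).
set t := x / (z n.+1 ^+ k * b n.+1).
have zn0 := vunits_neq0 (zU n.+1).
have xE : x = t * (z n.+1 ^+ k * b n.+1) by rewrite divfK // mulf_neq0 ?expf_neq0.
have zE : z n.+1 ^+ k ^+ d = z n ^+ e ^+ k by rewrite exprAC zS.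
have td : t ^+ d ^+ (d ^ n) \in vunits1 A.
  rewrite rpredX // -[t ^+ d]divr1.
  apply: (@veq_cancel _ _ (z n ^+ e ^+ k * (lead_coef F * b n.+1 ^+ d))); rewrite mul1r.
  have -> : t ^+ d * (z n ^+ e ^+ k * (lead_coef F * b n.+1 ^+ d)) = lead_coef F * x ^+ d.
    by rewrite [in RHS]xE !exprMn zE; ring.
  apply: veq_trans h1 _; apply: (@veq_trans _ _ _ (z n ^+ e ^+ k * (lead_coef G * b n ^+ e))).
    by have := veqM (veq_refl A m0) (veqX e yk); rewrite exprMn mulrCA exprAC.
  by apply: veqM (veq_sym h2); rewrite veq_refl // !expf_neq0 // (vunits_neq0 (zU n)).
rewrite -exprM -expnS in td; have [i ti] := unity_approx (zP n.+1) td.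
exists (i + k)%N; split; first by exists y.
rewrite {1}xE exprD -mulrA; apply: veqM ti _.
by rewrite veq_refl // mulf_neq0 ?expf_neq0.
Qed.

(** Solve [F.[x] = G.[y]] near [z n.+1 ^+ k * b n.+1], with [y] of label [k] one level below. *)
Lemma labelled_exists n k : exists x, labelled n k x.
Proof.
elim: n k => [|n IH] k; first by exists alpha; apply/labelled0.
have [y [yn yk]] := IH k; have yA := lev_notin yn.
have l0 := vunits_neq0 FU; have m0 := vunits_neq0 GU.
have h2 := edge_veq (bS n) (lev_notin (ray_lev n)).
have zE : z n.+1 ^+ k ^+ d = z n ^+ e ^+ k by rewrite exprAC zS.
pose t := z n.+1 ^+ k * b n.+1.
have tA : t \notin A.
  apply: contra (lev_notin (ray_lev n.+1)) => tA.
  have zkU := vunitsX k (zU n.+1); have [zk0 _ zkV] := vunitsP zkU.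
  by rewrite -(mulKf zk0 (b n.+1)) vrM.
have [||x [xy xt]] := @horner_large_root L A F t G.[y] FA FU _ tA.
- by move: d0; case: (size F) => [|[]].
- apply: veq_trans (horner_large GA GU yA) _.
  apply: (@veq_trans _ _ _ (z n ^+ e ^+ k * (lead_coef G * b n ^+ e))).
    by have := veqM (veq_refl A m0) (veqX e yk); rewrite exprMn mulrCA exprAC.
  rewrite /t exprMn zE [lead_coef F * _]mulrCA; apply: veqM (veq_sym h2).
  by rewrite veq_refl // !expf_neq0 // (vunits_neq0 (zU n)).
by exists x; split=> //; exists y.
Qed.

(** The vertices just below have congruent labels, so they coincide by induction; then
    [horner_large_inj] applies to [F]. *)
Lemma labelled_unique n k x x' : labelled n k x -> labelled n k x' -> x = x'.
Proof.
elim: n k x x' => [|n IH] k x x'; first by move=> /labelled0-> /labelled0->.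
move=> xk xk'; have [y yn xy] := xk.1; have [y' yn' xy'] := xk'.1.
have [l yl] := lev_labelled yn; have [l' yl'] := lev_labelled yn'.
have ll : l' = l %[mod d ^ n].
  by rewrite -(labelled_edge xk' yl' xy') (labelled_edge xk yl xy).
have yy := IH l _ _ yl (labelled_mod ll yl'); rewrite -yy in xy'.
apply: (horner_large_inj FA FU dU (lev_notin xk.1)); last by rewrite xy xy'.
exact: veq_trans xk'.2 (veq_sym xk.2).
Qed.

Lemma labelled_edge_iff n k l x y : labelled n.+1 k x -> labelled n l y ->
  F.[x] = G.[y] <-> k = l %[mod d ^ n].
Proof.
move=> xk yl; split=> [|kl]; first exact: labelled_edge yl.
have [y' yn' xy'] := xk.1; have [l' yl'] := lev_labelled yn'.
have l'l : l' = l %[mod d ^ n] by rewrite -(labelled_edge xk yl' xy').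
by rewrite (labelled_unique yl (labelled_mod l'l yl')).
Qed.

End Tree.

(** * Shifts *)

Section InverseLimit.
Context (d : nat).
Implicit Types h : Zd_lim d.

Lemma Zred0 n : Zred (0 : Zmod d n.+1) = 0.
Proof. by apply: (@addrI _ (Zred (0 : Zmod d n.+1))); rewrite -ZredD !addr0. Qed.

Lemma ZredN n (a : Zmod d n.+1) : Zred (- a) = - Zred a.
Proof. by apply/eqP; rewrite -addr_eq0 -ZredD addNr Zred0. Qed.

Lemma Zd_add h h' : exists k : Zd_lim d, forall n, k n = h n + h' n.
Proof.
have c n : Zred (h n.+1 + h' n.+1) = h n + h' n by rewrite ZredD !Zd_compat.
by exists (ZdLim c).
Qed.

Lemma Zd_sub h h' : exists k : Zd_lim d, forall n, k n = h n - h' n.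
Proof.
have c n : Zred (h n.+1 - h' n.+1) = h n - h' n by rewrite ZredD ZredN !Zd_compat.
by exists (ZdLim c).
Qed.

Hypothesis d0 : (0 < d)%N.

Lemma Zmod_card n : ((d ^ n).-1.+1 = d ^ n)%N.
Proof. by rewrite prednK // expn_gt0 d0. Qed.

Lemma Zred_val n (a : Zmod d n.+1) : val (Zred a) = (val a %% d ^ n)%N.
Proof. by congr modn; apply: Zmod_card. Qed.

Lemma Zd_val_red h n j : (j <= n)%N -> val (h j) = (val (h n) %% d ^ j)%N.
Proof.
move=> jn; rewrite -(subnK jn); elim: (n - j)%N => [|k IH].
  rewrite add0n modn_small // -[X in (_ < X)%N]Zmod_card; exact: ltn_ord.
rewrite IH addSn -(Zd_compat h (k + j)) Zred_val modn_dvdm //.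
by rewrite dvdn_exp2l // leq_addl.
Qed.

(** A prime dividing the gcd divides [d], and its exponent in the gcd is at most its exponent in
    [r], which is less than [r]. *)
Lemma gcd_exp_dvd r n : (0 < r)%N -> (gcdn r (d ^ n) %| d ^ r)%N.
Proof.
move=> r0; have g0 : (0 < gcdn r (d ^ n))%N by rewrite gcdn_gt0 r0.
apply/dvdn_partP => // p; rewrite mem_primes => /and3P[pp _ pg].
have pd : (p %| d)%N.
  have := dvdn_trans pg (dvdn_gcdr _ _).
  by rewrite Euclid_dvdX // => /andP[].
rewrite p_part; apply: dvdn_trans (dvdn_exp2r r pd); apply: dvdn_exp2l.
have lr : (logn p (gcdn r (d ^ n)) <= logn p r)%N by apply: dvdn_leq_log; rewrite ?dvdn_gcdl.
by apply: leq_trans lr _; apply/ltnW/ltn_logl.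
Qed.

(* An element of the limit that vanishes at level [r] is divisible by [r] at
   every level, since [gcd(r, d^n)] divides [d^r]. *)
Lemma Zd_multiple h r : (0 < r)%N -> h r = 0 -> forall n, exists c : Zmod d n, h n = c *+ r.
Proof.
move=> r0 hr n; have [nr|rn] := leqP n r.
  exists 0; rewrite mul0rn; apply: val_inj.
  by rewrite (Zd_val_red h nr) hr /= mod0n.
have dk : (d ^ r %| val (h n))%N.
  by rewrite /dvdn -(Zd_val_red h (ltnW rn)) hr.
have /dvdnP[q qE] : (gcdn r (d ^ n) %| val (h n))%N by apply: dvdn_trans dk; apply: gcd_exp_dvd.
have dn0 : (0 < d ^ n)%N by rewrite expn_gt0 d0.
have [a _ aE] := Bezoutl r dn0.
(* [Bezoutl] makes the gcd plus [a * r] divisible by [d ^ n], hence the sign of the witness. *)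
exists (- inZp (a * q)); rewrite mulNrn; apply/eqP; rewrite -addr_eq0; apply/eqP/val_inj.
have -> : (inZp (a * q) : Zmod d n) *+ r = inZp (a * q * r).
  by rewrite [LHS]Zp_mulrn; apply: val_inj; rewrite /= modnMml.
move: qE => /= qE; rewrite /= modnDmr qE Zmod_card mulnAC [(q * _)%N]mulnC -mulnDl.
by apply/eqP; apply: dvdn_mulr; rewrite gcdnC.
Qed.

End InverseLimit.

Section FiniteIndex.
Context (d : nat) (T : Defs.rgraph) (phi : rgraph_iso (dtree d) T) (G : set (Aut T)) (r : nat).
Local Notation tact h := (aut_transport phi (dtree_act h) : Aut T).
Hypothesis GM : forall x y : Aut T, G x -> G y -> G (x * y)%g.
Hypothesis Gr : forall h : Zd_lim d, h r = 0 -> G (tact h).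

Lemma tactM (h h' k : Zd_lim d) : (forall n, k n = h n + h' n) ->
  tact k = (tact h * tact h')%g.
Proof.
move=> kE; apply: rgraph_isoP => x /=; rewrite iso_funK /dtree_shift /= kE.
by rewrite addrA.
Qed.

(** The coset of the shift by [h] depends only on [h r], so there are at most as many cosets as
    elements of [Zmod d r]. *)
Lemma shift_subgroup_finite_index :
  let H := range (fun h : Zd_lim d => tact h) in finite_index (G `&` H)%classic H.
Proof.
move=> H; pose C (x : Aut T) := [set (x * a)%g | a in (G `&` H)%classic]%classic.
have sub (h h' : Zd_lim d) : h r = h' r -> (C (tact h) `<=` C (tact h'))%classic.
  move=> hh x [a [Ga [k _ kE]] <-].
  have [j jE] := Zd_sub h h'; have [i iE] := Zd_add j k.
  have jr : j r = 0 by rewrite jE hh subrr.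
  exists (tact j * a)%g.
    split; first by apply: GM => //; apply: Gr.
    by exists i => //; rewrite (tactM iE) kE.
  rewrite mulgA -(@tactM h' j h) // => n.
  by rewrite jE addrC subrK.
have pick (u : Zmod d r) : exists h : Zd_lim d, (exists h' : Zd_lim d, h' r = u) -> h r = u.
  have [[h hu]|no] := pselect (exists h' : Zd_lim d, h' r = u); first by exists h.
  have c n : Zred (0 : Zmod d n.+1) = 0 by apply: Zred0.
  by exists (ZdLim c).
have [p pP] := choice pick.
apply: (@sub_finite_set _ _ (range (fun u : 'I_(d ^ r).-1.+1 => C (tact (p u))))).
  move=> _ [_ [h _ <-] <-]; exists (h r) => //.
  have hr : p (h r) r = h r by apply: pP; exists h.
  by apply/seteqP; split; apply: sub.
by apply: finite_image; apply: finite_finset.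
Qed.

End FiniteIndex.

Section Labelling.
Context (K : fieldType) (L : closedFieldType) (iota : {rmorphism K -> L}).
Context (f g : {poly K}) (alpha : K) (d : nat).
Local Notation F := (map_poly iota f).
Local Notation G := (map_poly iota g).
Local Notation lev := (lev F G (iota alpha)).

Lemma back_path_lev x : in_back_path iota f g alpha x <-> exists n, lev n x.
Proof.
split=> [[s]|[n]].
  suff: forall n a, lev n a -> path (corr iota f g) a s -> x \in a :: s -> exists n, lev n x.
    by move=> h; apply: (h 0%N).
  elim: s => [|y s IH] n a an /=; first by move=> _; rewrite mem_seq1 => /eqP->; exists n.
  case/andP=> /eqP ay ys; rewrite inE => /predU1P[->|]; first by exists n.
  by apply: (IH n.+1 y) => //; exists a.
suff: lev n x -> exists2 s, path (corr iota f g) (iota alpha) s & last (iota alpha) s = x.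
  by move=> h /h[s ps <-]; exists s; rewrite ?mem_last.
elim: n x => [x ->|n IH x [y /IH[s ps sy] xy]]; first by exists [::].
exists (rcons s x); last by rewrite last_rcons.
by rewrite rcons_path ps sy /corr xy eqxx.
Qed.

Context (phi : forall n, Zmod d n -> L).
Hypothesis phi_lev : forall n a, lev n (@phi n a).
Hypothesis phi_onto : forall n x, lev n x -> exists a, x = @phi n a.
Hypothesis phi_inj : forall n, injective (@phi n).
Hypothesis phi_edge : forall n a b, F.[@phi n.+1 a] = G.[@phi n b] <-> Zred a = b.
Hypothesis lev_inj : forall n m x, lev n x -> lev m x -> n = m.

(** [lev_inj] gives injectivity across levels and shows that edges join consecutive levels. *)
Lemma labelling_iso : exists Phi : rgraph_iso (dtree d) (back_tree iota f g alpha),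
  forall n a, sval (Phi (Tagged (Zmod d) (a : Zmod d n))) = @phi n a.
Proof.
have bp n a : in_back_path iota f g alpha (@phi n a).
  by apply/back_path_lev; exists n.
pose u (x : dtree d) : back_tree iota f g alpha := exist _ (@phi (tag x) (tagged x)) (bp _ _).
have u_onto (y : back_tree iota f g alpha) : exists x, u x = y.
  case: y => y yp; have [n yn] := (back_path_lev y).1 yp.
  have [a ya] := phi_onto yn; exists (Tagged (Zmod d) a).
  by apply: back_tree_inj; rewrite /= ya.
have u_inj : injective u.
  move=> [n a] [m b] /(congr1 sval)/= ab.
  have nm : n = m by apply: lev_inj (phi_lev a) _; rewrite ab.
  by subst m; rewrite (phi_inj ab).
have [w wP] := choice u_onto.
have wK : cancel u w by move=> x; apply: u_inj; rewrite wP.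
have ue (x y : dtree d) : edge x y <-> edge (u x) (u y).
  case: x y => [m a] [n b]; split.
    case=> /= mn; subst m => ab; apply/eqP; symmetry; apply/phi_edge; exact: ab.
  move=> /eqP /= ab; have mn : m = n.+1.
    by apply: lev_inj (phi_lev a) _; exists (@phi n b).
  by subst m; split=> //=; apply/phi_edge.
have ur : u (Defs.root (dtree d)) = Defs.root (back_tree iota f g alpha).
  by apply: back_tree_inj => /=; exact: (@phi_lev 0%N 0).
by exists (RGraphIso wK wP ue ur).
Qed.

End Labelling.

(** In a cyclic group, inclusion of subgroups amounts to divisibility of their orders. *)
Lemma cyclic_order_dvd_mem (gT : finGroupType) (H C : {group gT}) (x : gT) :
  cyclic H -> C \subset H -> x \in H -> (x ^+ #|C| = 1)%g -> x \in C.
Proof.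
move=> cH CH xH xC; rewrite -cycle_subG -(cardSg_cyclic cH) ?cycle_subG //.
by rewrite -[#|_|]/#[x]%g order_dvdn xC.
Qed.

(** * Shifts realized by Galois automorphisms *)

Section GaloisShifts.
Context (K : fieldType) (charK : [pchar K] =i pred0) (v : discrete_valuation K).
Context (L : closedFieldType) (iota : {rmorphism K -> L}).
Hypothesis algL : forall x : L, algebraicOver iota x.
Context (A : valring L).
Hypothesis AK : forall a, (iota a \in A) = (a \in vring v).
Context (f g : {poly K}) (alpha : K).
Local Notation F := (map_poly iota f).
Local Notation G := (map_poly iota g).
Local Notation d := (size F).-1.
Local Notation e := (size G).-1.
Hypotheses (FA : F \is a polyOver A) (GA : G \is a polyOver A).
Hypotheses (FU : lead_coef F \in vunits A) (GU : lead_coef G \in vunits A).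
Hypotheses (e0 : (0 < e)%N) (ed : (e < d)%N) (dU : d%:R \in vunits A) (cop : coprime e d).
Hypothesis alphaA : iota alpha \notin A.
Context (b z : nat -> L).
Hypotheses (b0 : b 0%N = iota alpha) (bS : forall n, F.[b n.+1] = G.[b n]).
Hypotheses (zP : forall n, (d ^ n)%N.-primitive_root (z n)).
Hypothesis (zS : forall n, z n.+1 ^+ d = z n ^+ e).
Local Notation labelled := (labelled A F G (iota alpha) b z).
Local Notation lev := (lev F G (iota alpha)).
Context (phi : forall n, Zmod d n -> L).
Hypothesis phiP : forall n (a : Zmod d n), labelled n (val a) (@phi n a).

Let d0 : (0 < d)%N. Proof. exact: leq_ltn_trans ed. Qed.
Let labelledU := labelled_unique FA GA FU GU e0 dU cop alphaA b0 bS zP zS.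

Lemma phi_lev n a : lev n (@phi n a). Proof. exact: (phiP a).1. Qed.

Lemma phi_labelled n k x : labelled n k x -> x = @phi n (inZp k).
Proof.
move=> xk; apply: labelledU (phiP _); apply: (labelled_mod zP) xk.
by rewrite /= Zmod_card // modn_mod.
Qed.

Lemma phi_onto n x : lev n x -> exists a, x = @phi n a.
Proof.
move=> xn; have [k xk] := lev_labelled FA GA FU GU e0 alphaA b0 bS zP zS xn.
by exists (inZp k); apply: phi_labelled.
Qed.

Lemma Zmod_eqP n (a c : Zmod d n) : val a = val c %[mod d ^ n] -> a = c.
Proof.
move=> h; apply: val_inj; move: h.
by rewrite !modn_small // -[X in (_ < X)%N](Zmod_card d0); apply: ltn_ord.
Qed.

Lemma phi_inj n : injective (@phi n).
Proof.
move=> a c ac; apply: Zmod_eqP; apply: (labelled_inj dU zP (phiP a)).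
by rewrite ac; apply: phiP.
Qed.

Lemma phi_edge n a c : F.[@phi n.+1 a] = G.[@phi n c] <-> Zred a = c.
Proof.
have h := labelled_edge_iff FA GA FU GU e0 dU cop alphaA b0 bS zP zS (phiP a) (phiP c).
split=> [/h ac|ac]; first by apply: Zmod_eqP; rewrite Zred_val // modn_mod.
by apply/h; rewrite -ac Zred_val // modn_mod.
Qed.

Lemma lev_gal (s : Defs.galois iota) n x : lev n x -> lev n (s x).
Proof.
elim: n x => [x ->|n IH x [y yn xy]]; first exact: gal_fix.
by exists (s y); [apply: IH|rewrite !gal_horner xy].
Qed.

Section Level.
Context (n : nat).
Local Notation N := (d ^ n)%N.

(** The roots of unity are included so that fixing [z n] is a condition on the finite group of this
    level. *)
Let X : seq L := [seq @phi n a | a <- enum 'I_(d ^ n).-1.+1] ++ mkseq (fun i => z n ^+ i) N.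

Let phiX (a : Zmod d n) : @phi n a \in X.
Proof. by rewrite mem_cat map_f // mem_enum. Qed.

Let zX k : z n ^+ k \in X.
Proof.
rewrite mem_cat -(prim_expr_mod (zP n)); apply/orP; right; apply/mapP.
by exists (k %% N)%N; rewrite // mem_iota ltn_mod expn_gt0 d0.
Qed.

Let stabX (s : Defs.galois iota) x : x \in X -> s x \in X.
Proof.
rewrite mem_cat => /orP[/mapP[a _ ->]|/mapP[i _ ->]].
  by have [c ->] := phi_onto (lev_gal s (phi_lev a)).
have [j ->] : exists j : 'I_N, s (z n ^+ i) = z n ^+ j.
  have [|j jE] := @prim_rootP _ _ _ (zP n) (s (z n ^+ i)); last by exists j.
  by rewrite -rmorphXn exprAC (prim_expr_order (zP n)) expr1n rmorph1.
exact: zX.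
Qed.

Let J := decomp_stab stabX A (z n).
Let NU : N%:R \in vunits A. Proof. by rewrite natrX vunitsX. Qed.
Let zF : z n \in finF iota X. Proof. by apply: finF_mem; rewrite -[z n]expr1. Qed.
Let phiF a : @phi n a \in finF iota X. Proof. by apply: finF_mem. Qed.
Let bE : b n = @phi n 0.
Proof.
rewrite (_ : 0 = inZp 0 :> Zmod d n); last by apply: val_inj; rewrite /= mod0n.
apply: phi_labelled; split; first exact: (ray_lev _ bS).
by rewrite expr0 mul1r veq_refl // (notin_neq0 (lev_notin FA GA GU e0 alphaA (ray_lev b0 bS n))).
Qed.

(** [p] preserves the maximal ideal of [A] and fixes [z n], so it sends the class of
    [z n ^+ a * b n] to [z n ^+ a] times the class of the image of [b n], whose label is [c]. *)
Let J_shift p : p \in J -> exists c : Zmod d n, forall a, lift stabX p (@phi n a) = @phi n (c + a).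
Proof.
rewrite [_ \in J]finset.in_set => /andP[pD /eqP pz].
have [c pb] := phi_onto (lev_gal (lift stabX p) (phi_lev (0 : Zmod d n))).
exists c => a; have [an av] := phiP a; have [_ cv] := phiP c.
suff: labelled n (val a + val c) (lift stabX p (@phi n a)).
  move/phi_labelled => ->; congr (phi _); apply: val_inj => /=.
  by rewrite addnC.
split; first exact: lev_gal.
have bn0 : b n != 0 by rewrite (notin_neq0 (lev_notin FA GA GU e0 alphaA (ray_lev b0 bS n))).
have z0 := vunits_neq0 (zU A zP n).
have w0 : z n ^+ val a * b n != 0 by rewrite mulf_neq0 ?expf_neq0.
set w := z n ^+ val a * b n in av w0.
have wF : w \in finF iota X by rewrite finFM ?finFX // bE.
apply: (@veq_trans _ _ _ (lift stabX p w)).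
  rewrite veqE -fmorph_div -[1](rmorph1 (lift stabX p)) -rmorphB.
  set m := _ / w - 1.
  have mF : m \in finF iota X by rewrite rpredB ?rpred1 // rpred_div.
  have [->|m0] := eqVneq m 0; first by rewrite rmorph0 rpred0.
  rewrite -(divfK m0 (lift stabX p m)) vmaxMr ?av //.
  by rewrite vunits_vr // (decomp_ratio algL pD).
rewrite bE in cv; rewrite rmorphM rmorphXn pz bE pb exprD -mulrA; apply: veqM cv.
by rewrite veq_refl // expf_neq0.
Qed.

(** The shifts induced by [J] form a subgroup [C] of [Zmod d n]. Ramification yields [k] in [K] with
    the size of [b n ^+ #|C|]; comparing values, [d ^ n] divides [|v alpha| * #|C|], as [e] is prime
    to [d]. So [#|C|] kills all multiples of [|v alpha|], and cyclicity puts them in [C]. *)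
Lemma gal_shift (c : Zmod d n) :
  exists s : Defs.galois iota, forall a, s (@phi n a) = @phi n (c *+ `|v alpha|%N + a).
Proof.
have JG := decomp_stab_group_set stabX A zF; pose Jg := Group JG.
have /choice[cf cfP] : forall p, exists c : Zmod d n, p \in J ->
    forall a, lift stabX p (@phi n a) = @phi n (c + a).
  move=> p; have [/J_shift[c' h]|pJ] := boolP (p \in J); first by exists c'.
  by exists 0.
have JD p : p \in J -> p \in decomp stabX A by rewrite [_ \in J]finset.in_set => /andP[].
pose C : {set 'I_(d ^ n).-1.+1} := [set (cf p : 'I_(d ^ n).-1.+1) | p in J].
have cf_inj : {in J &, injective cf}.
  move=> p q pJ qJ pq; rewrite -(liftP (decomp_gal (JD p pJ))) -(liftP (decomp_gal (JD q qJ))).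
  apply/gperm_eqP => x; rewrite mem_cat => /orP[/mapP[a _ ->]|/mapP[i _ ->]].
    by rewrite !cfP // pq.
  have hz r : r \in J -> lift stabX r (z n) = z n.
    by rewrite [_ \in J]finset.in_set => /andP[_ /eqP].
  by rewrite !rmorphXn !hz.
have cardC : #|C| = #|J| by rewrite card_in_imset.
have CG : group_set C.
  apply/group_setP; split.
    apply/imsetP; exists 1%g; first exact: (group1 Jg).
    apply/esym; rewrite -[cf 1%g]addr0; apply: (@phi_inj n).
    by rewrite -cfP ?(group1 Jg) // lift1.
  move=> _ _ /imsetP[p pJ ->] /imsetP[q qJ ->]; apply/imsetP; exists (p * q)%g.
    exact: (groupM (G := Jg)).
  have pqJ : (p * q)%g \in J by apply: (groupM (G := Jg)).
  apply: (@phi_inj n); rewrite -[cf (p * q)%g]addr0 -(cfP _ pqJ).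
  rewrite (lift_mul (decomp_gal (JD p pJ)) (decomp_gal (JD q qJ)) (phiF 0)).
  by rewrite (cfP p pJ) (cfP q qJ) addr0 addrC.
pose Cg := Group CG.
have Tcard : #|[set: 'I_(d ^ n).-1.+1]| = N by rewrite finset.cardsT card_ord Zmod_card.
have Cdvd : (#|C| %| N)%N by have := cardSg (finset.subsetT Cg); rewrite Tcard.
have CU : #|C|%:R \in vunits A := vunits_dvdn Cdvd NU.
have bn0 : b n != 0 by rewrite (notin_neq0 (lev_notin FA GA GU e0 alphaA (ray_lev b0 bS n))).
have bF : b n \in finF iota X by rewrite bE.
have NP : (0 < N)%N by rewrite expn_gt0 d0.
have JU : #|decomp_stab stabX A (z n)|%:R \in vunits A by rewrite -/J -cardC.
have [k k0 kU] :=
  decomp_stab_ramification charK algL AK bF bn0 zF (prim_expr_order (zP n)) NP NU JU.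
have alpha0 : alpha != 0 by rewrite -(fmorph_eq0 iota) (notin_neq0 alphaA).
have vk : v k * N%:Z = v alpha * (e ^ n * #|C|)%:Z.
  have : iota (k ^+ N / alpha ^+ (e ^ n * #|C|)) \in vunits A.
    have h := lev_power FA GA FU GU e0 alphaA (ray_lev b0 bS n).
    have -> : iota (k ^+ N / alpha ^+ (e ^ n * #|C|)) =
        (iota k / b n ^+ #|J|) ^+ N * (b n ^+ N / iota alpha ^+ (e ^ n)) ^+ #|C|.
      rewrite fmorph_div !rmorphXn !exprMn !exprVn -!exprM -cardC [(N * _)%N]mulnC.
      by rewrite mulrA divfK // expf_neq0.
    by rewrite vunitsM ?vunitsX.
  rewrite (vunits_iota AK) => /andP[_]; rewrite dvalM ?invr_eq0 ?expf_neq0 //.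
  by rewrite dvalV ?expf_neq0 // !dvalX // subr_eq0 => /eqP.
have Ndvd : (N %| `|v alpha| * #|C|)%N.
  have : (N %| `|v alpha|  * (e ^ n * #|C|))%N.
    by move/(congr1 absz): vk; rewrite !abszM /= => <-; rewrite dvdn_mull.
  rewrite mulnCA Gauss_dvdr // coprimeXl // coprimeXr //.
  by rewrite coprime_sym.
have mem : (c *+ `|v alpha|%N : Zmod d n) \in C.
  apply: (@cyclic_order_dvd_mem _ [set: 'I_(d ^ n).-1.+1]%G Cg).
  - by apply/cyclicP; exists Zp1; apply: Zp_cycle.
  - exact: finset.subsetT.
  - by rewrite inE.
  have -> : c *+ `|v alpha|%N = inZp (c * `|v alpha|) by apply: Zp_mulrn.
  rewrite Zp_expg; apply: val_inj; rewrite /= modnMml -mulnA.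
  apply/eqP; rewrite -[_ == _]/(_ %| _)%N; apply: dvdn_mull.
  by apply: dvdn_trans Ndvd; rewrite Zmod_card.
have /imsetP[p pJ ->] := mem; exists (lift stabX p) => a.
exact: cfP.
Qed.

End Level.

(** Going down one level, the image of the vertex below is the vertex below the image, and [h] is
    compatible with reduction. *)
Lemma shift_lower (s : Defs.galois iota) (h : Zd_lim d) n :
  (forall a, s (@phi n a) = @phi n (h n + a)) ->
  forall j a, (j <= n)%N -> s (@phi j a) = @phi j (h j + a).
Proof.
move=> hn j a jn; move: a; rewrite -(subKn jn); elim: (n - j)%N => [|k IH].
  by rewrite subn0.
(* If [n <= k], truncated subtraction makes both levels 0. *)
have [nk|kn] := leqP n k; first by move: IH; rewrite (eqP nk) (eqP (leqW nk : n - k.+1 == 0)%N).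
have nkE : (n - k)%N = (n - k.+1).+1 by rewrite subnSK.
rewrite nkE in IH; move: (n - k.+1)%N IH => m IH a.
have [a' a'E] : exists a' : Zmod d m.+1, Zred a' = a.
  exists (inZp (val a)); apply: Zmod_eqP; rewrite Zred_val // modn_mod /=.
  by apply: modn_dvdm; rewrite Zmod_card // dvdn_exp2l.
have [c cE] := phi_onto (lev_gal s (phi_lev a)); rewrite cE; congr (phi _).
have : F.[@phi m.+1 (h m.+1 + a')] = G.[@phi m c].
  by rewrite -IH -cE !gal_horner; congr (s _); apply/phi_edge.
by move/phi_edge <-; rewrite ZredD Zd_compat a'E.
Qed.

Lemma shift_in_galois (h : Zd_lim d) : h `|v alpha|%N = 0 ->
  exists s : Defs.galois iota, forall n a, s (@phi n a) = @phi n (h n + a).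
Proof.
move=> hr; have v0 : (0 < `|v alpha|)%N.
  have alpha0 : alpha != 0 by rewrite -(fmorph_eq0 iota) (notin_neq0 alphaA).
  by move: alphaA; rewrite AK vringE // lt0n absz_eq0; apply: contraNneq => ->.
have /choice[s sP] n : exists s : Defs.galois iota, forall a, s (@phi n a) = @phi n (h n + a).
  by have [c hc] := Zd_multiple d0 v0 hr n; have [s sc] := gal_shift c; exists s; rewrite hc.
(* Pairs whose second member is the image of the first under all late [s n]. By [shift_lower] these
   images are constant on a vertex from its own level on, so the domain contains the whole tree. *)
pose R : set (L * L) := [set p | exists m, forall n, (m <= n)%N -> s n p.1 = p.2]%classic.
have [|t tR] := @partial_aut_extend K L iota algL R.
  have common x x' y y' : R (x, x') -> R (y, y') ->
      exists m, forall n, (m <= n)%N -> s n x = x' /\ s n y = y'.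
    move=> [m1 h1] [m2 h2]; exists (maxn m1 m2) => n; rewrite geq_max => /andP[n1 n2].
    by split; [apply: h1|apply: h2].
  split.
  - by move=> a; exists 0%N => n _; apply: gal_fix.
  - move=> x x' y y' xx' yy'; have [m mP] := common _ _ _ _ xx' yy'.
    by exists m => n /mP[/= sx sy]; rewrite rmorphB sx sy.
  - move=> x x' y y' xx' yy'; have [m mP] := common _ _ _ _ xx' yy'.
    by exists m => n /mP[/= sx sy]; rewrite rmorphM sx sy.
  - by move=> x x' [m mP]; rewrite -[x'](mP m (leqnn m)) fmorph_eq0.
exists t => n a; apply: tR; exists n => m nm /=.
exact: shift_lower (sP m) _ _ nm.
Qed.
End GaloisShifts.

(** * The Galois image contains a finite-index group of shifts *)

Local Open Scope classical_set_scope.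
Local Open Scope ring_scope.

Lemma gal_image_mul (K : fieldType) (L : closedFieldType) (iota : {rmorphism K -> L})
    (f g : {poly K}) (alpha : K) (x y : Aut (back_tree iota f g alpha)) :
  gal_image iota f g alpha x -> gal_image iota f g alpha y ->
  gal_image iota f g alpha (x * y)%g.
Proof.
move=> [s _ <-] [t _ <-]; have [r rE] := gal_comp_exists s t.
by exists r => //; apply: rgraph_isoP => u; apply: back_tree_inj; rewrite /= rE.
Qed.

Unset Implicit Arguments.

Theorem theorem2 (K : fieldType) (charK : [pchar K] =i pred0)
    (v : discrete_valuation K)
    (L : closedFieldType) (iota : {rmorphism K -> L})
    (algL : forall x : L, algebraicOver iota x)
    (f g : {poly K}) (alpha : K)
    (deg_g_ge1 : (1 <= pdeg g)%N) (polarized : (pdeg g < pdeg f)%N)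
    (good_red : good_reduction v f g)
    (unit_deg_f : vunit v (pdeg f)%:R) (unit_deg_g : vunit v (pdeg g)%:R)
    (coprime_deg : gcdn (pdeg f) (pdeg g) = 1%N)
    (alpha_nonint : alpha \notin vring v) :
  exists H : set (Aut (back_tree iota f g alpha)),
    dadic_subgroup (pdeg f) H /\
    finite_index (gal_image iota f g alpha `&` H) H.
Proof.
have [A AK] := valuation_extension v iota.
have dE (p : {poly K}) : pdeg p = (size (map_poly iota p)).-1 by rewrite size_map_poly.
have unitA x : vunit v x -> iota x \in vunits A.
  by case=> x0 xA xVA; rewrite inE fmorph_eq0 x0 -fmorphV !AK xA.
have polyA (p : {poly K}) : p \is a polyOver (vring v) -> map_poly iota p \is a polyOver A.
  rewrite qualifE => /allP pA; apply/polyOverP => i; rewrite coef_map AK.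
  case: (ltnP i (size p)) => [/(mem_nth 0)/pA//|/(nth_default 0) ->].
  by rewrite inE eqxx.
have [/polyA FA /polyA GA /unitA FU /unitA GU] := good_red.
rewrite -!lead_coef_map in FU GU.
have dU := unitA _ unit_deg_f; rewrite rmorph_nat in dU.
have cop : coprime (pdeg g) (pdeg f) by rewrite coprime_sym; apply/eqP.
rewrite !dE in deg_g_ge1 polarized dU cop *.
have alphaA : iota alpha \notin A by rewrite AK.
have [b [b0 bS]] := ray_exists (iota alpha) polarized.
have dN0 n : ((size (map_poly iota f)).-1 ^ n)%:R != 0 :> L.
  by rewrite natrX (vunits_neq0 (vunitsX n dU)).
have [z zPS] := twisted_prim_roots dN0 cop.
have zP n := (zPS n).1; have zS n := (zPS n).2.
pose phi n (a : Zmod (size (map_poly iota f)).-1 n) : L :=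
  projT1 (cid (labelled_exists FA GA FU GU deg_g_ge1 polarized alphaA b0 bS zP zS n (val a))).
have phiP n a : labelled A _ _ _ b z n (val a) (phi n a) := projT2 (cid _).
have [Phi PhiE] := labelling_iso (phi_lev phiP)
  (phi_onto FA GA FU GU deg_g_ge1 polarized dU cop alphaA b0 bS zP zS phiP)
  (phi_inj polarized dU zP phiP)
  (phi_edge FA GA FU GU deg_g_ge1 polarized dU cop alphaA b0 bS zP zS phiP)
  (lev_inj FA GA FU GU deg_g_ge1 polarized alphaA).
exists (range (fun h => aut_transport Phi (dtree_act h))); split; first by exists Phi.
(* Galois realizes every shift that is trivial at level [|v alpha|], so the size of that level
   bounds the index. *)
apply: (shift_subgroup_finite_index (r := `|v alpha|)) => [x y|h hr].
  exact: gal_image_mul.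
have [s sP] := shift_in_galois charK algL AK FA GA FU GU deg_g_ge1 polarized dU cop alphaA
  b0 bS zP zS phiP hr.
exists s => //; apply: rgraph_isoP => x; apply: back_tree_inj.
rewrite -(iso_invK Phi x); case: (iso_inv Phi x) => n a /=.
by rewrite iso_funK PhiE sP -PhiE.
Qed.
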